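(* Let $H$ be a fixed strictly balanced graph with at least one edge, having $v$ vertices, $m$ edges, $a$ automorphisms, and density $d=m/v$. Let the edges of the complete graph $K_n$ be given independent uniform $[0,1]$ edge weights, and let $W=W_n$ denote the minimum weight of a subgraph of $K_n$ isomorphic to $H$. Then for any non-negative sequence $z=z(n)$, as $n\to\infty$, $$\Pr\left(W\ge \frac{z}{n^{1/d}}\right)=\exp\left\{-\frac{z^{m}}{m!\,a}\right\}+o(1).$$ Also, as $n\to\infty$, $$\mathbb{E}(W)\sim n^{-1/d}\,\frac{(m!\,a)^{1/m}}{m}\,\Gamma\left(\frac1m\right).$$
   Context: The density of a (finite, simple) graph $H$ is $\mathrm{den}(H)=e(H)/v(H)$, where $e(H)$ and $v(H)$ are the numbers of edges and vertices of $H$. $H$ is strictly balanced if $\mathrm{den}(H)>\mathrm{den}(H')$ for all strict (proper, with non-empty vertex set) subgraphs $H'\subset H$. The weight of a subgraph is the sum of the weights of its edges; subgraphs are not necessarily induced. The number of automorphisms $a$ is the cardinality of the automorphism group of $H$. $\Gamma$ is the Gamma function. $f(n)\sim g(n)$ means $f(n)/g(n)\to1$ as $n\to\infty$. $W$ is defined for $n\ge v$. *)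

(* Defs.v *)
From HB Require Import structures.
From mathcomp Require Import all_boot all_order all_algebra all_fingroup.
From mathcomp Require Import all_classical all_reals all_analysis.

Set Implicit Arguments.
Unset Strict Implicit.
Unset Printing Implicit Defensive.

Import Order.TTheory GRing.Theory Num.Theory.
Import numFieldNormedType.Exports.

Local Open Scope classical_set_scope.
Local Open Scope ring_scope.

(** A simple graph with vertices in the ambient finite type [T] is a vertex set
    together with a set of 2-element subsets of it, so that the subgraphs of a
    graph (not necessarily induced) live in the same type. *)
Record graph (T : finType) := Graph {
  graph_val : {set T} * {set {set T}};
  graph_valP : [forall e in graph_val.2, (e \subset graph_val.1) && (#|e| == 2)]
}.

HB.instance Definition _ (T : finType) := [isSub for @graph_val T].
HB.instance Definition _ (T : finType) := [Finite of graph T by <:].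

Definition vertices (T : finType) (G : graph T) : {set T} := (graph_val G).1.

Definition edges (T : finType) (G : graph T) : {set {set T}} := (graph_val G).2.

Definition subgraph (T : finType) (G H : graph T) : bool :=
  (vertices G \subset vertices H) && (edges G \subset edges H).

Lemma complete_graph_subproof (n : nat) :
  [forall e in [set e : {set 'I_n} | #|e| == 2]%SET,
     (e \subset [set: 'I_n]%SET) && (#|e| == 2)].
Proof. by apply/forall_inP => e; rewrite inE finset.subsetT. Qed.

Definition complete_graph (n : nat) : graph 'I_n :=
  @Graph 'I_n ([set: 'I_n], [set e : {set 'I_n} | #|e| == 2])%SET
    (complete_graph_subproof n).

(** [f] only matters on the vertices of [G]. *)
Definition isomorphic (T U : finType) (G : graph T) (K : graph U) : Prop :=
  exists f : T -> U,
    [/\ {in vertices G &, injective f},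
        [set f x | x in vertices G]%SET = vertices K
      & [set [set f x | x in e] | e : {set T} in edges G]%SET = edges K].

(** The permutations of [vertices H] are represented by the permutations of [T]
    that fix every other point. *)
Definition automorphisms (T : finType) (H : graph T) : {set {perm T}} :=
  [set s : {perm T} | perm_on (vertices H) s &&
    ([set [set s x | x in e] | e : {set T} in edges H] == edges H)]%SET.

Definition den (T : finType) (H : graph T) : rat :=
  #|edges H|%:R / #|vertices H|%:R.

Definition strictly_balanced (T : finType) (H : graph T) : Prop :=
  forall H' : graph T, subgraph H' H -> H' != H -> vertices H' != finset.set0 ->
    den H' < den H.

Definition weight (R : realType) (T : finType) (w : {set T} -> R)
    (G : graph T) : R :=
  \sum_(e in edges G) w e.

(** The infimum is over a finite set: it is a minimum as soon as [K] contains a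
    copy of [H] (see [min_weightP]), and [0] by convention otherwise. *)
Definition min_weight (R : realType) (T U : finType) (H : graph T)
    (K : graph U) (w : {set U} -> R) : R :=
  inf [set weight w G | G in [set G : graph U | subgraph G K /\ isomorphic H G]].

Lemma min_weightP (R : realType) (T U : finType) (H : graph T) (K : graph U)
    (w : {set U} -> R) :
  (exists G, subgraph G K /\ isomorphic H G) ->
  exists G, [/\ subgraph G K, isomorphic H G, min_weight H K w = weight w G &
    forall G', subgraph G' K -> isomorphic H G' -> weight w G <= weight w G'].
Proof.
move=> [G0 [sG0 iG0]].
pose p G := subgraph G K && `[< isomorphic H G >].
have p0 : p G0 by rewrite /p sG0; apply/asboolP.
case: (@arg_minP _ _ _ G0 p (weight w) p0) => G /andP[sG /asboolP iG] minG.
have lbG G' : subgraph G' K -> isomorphic H G' -> weight w G <= weight w G'.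
  by move=> sG' iG'; apply: minG; rewrite /p sG'; apply/asboolP.
exists G; split=> //; apply/eqP; rewrite eq_le; apply/andP; split.
  apply: ge_inf; last by exists G.
  by exists (weight w G) => _ [G' [sG' iG'] <-]; exact: lbG.
apply: lb_le_inf; first by exists (weight w G), G.
by move=> _ [G' [sG' iG'] <-]; exact: lbG.
Qed.

Definition mutually_independent (R : realType) (d : measure_display)
    (Omega : measurableType d) (P : probability Omega R) (I : finType)
    (A : {set I}) (X : I -> {RV P >-> R}) : Prop :=
  forall (B : {set I}) (S : I -> set R), B \subset A ->
    (forall i, measurable (S i)) ->
    P (\bigcap_(i in [set` B]) (X i @^-1` S i)) =
    (\prod_(i in B) P (X i @^-1` S i))%E.

Definition uniform01 (R : realType) (d : measure_display)
    (Omega : measurableType d) (P : probability Omega R)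
    (X : {RV P >-> R}) : Prop :=
  forall S : set R, measurable S ->
    distribution P X S = uniform_prob (@ltr01 R) S.

(** The Euler integral, meaningful for [0 < x]. *)
Definition Gamma (R : realType) (x : R) : R :=
  \int[lebesgue_measure]_(t in `]0, +oo[) (t `^ (x - 1) * expR (- t)).

Definition asymp_equiv (R : realType) (f g : nat -> R) : Prop :=
  f n / g n @[n --> \oo] --> (1 : R).

(* Main.v *)
(** Put [y = n ^ (- 1 / m)] and [t = z * y ^ v], so that [t = z / n ^ (1 / d)]. A
    fixed copy of [H] has weight below [t <= 1] with probability [t ^ m / m!],
    and there are [n ^_ v / a] copies, so the expected number of light copies
    tends to [z ^ m / (m! a)]. The Chen-Stein method compares the number [Z] of
    light copies to a Poisson variable; only [P(Z = 0)] is needed, and for it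
    the mean value theorem applied to [u |-> E[u ^ Z] exp (- E[Z] u)] on [0, 1]
    suffices. The error comes from pairs of distinct copies sharing an edge:
    their union has [e] edges and [k] vertices with [v e > m k] by strict
    balancedness, so the pairs on [k] vertices contribute
    [O(n ^ k t ^ e) = O(y)].

    For the expectation, the limit law has to be integrated over [z], which
    requires an integrable bound on [P(W >= t)]. The Poisson estimate gives
    [P(W >= t) = O(max (1 / z) s)] with [s] a small power of [1 / n]; as [W] is at
    most [m], [s] is itself at most a negative power of [z]. Splitting the
    vertices into a bounded number of blocks, whose minimum weights are
    independent, raises this to a power and yields [O(1 / z ^ 2)]. *)
Require Import Defs.
From mathcomp Require Import all_boot all_order all_algebra all_fingroup.
From mathcomp Require Import all_classical all_reals all_analysis.
From mathcomp Require Import measurable_realfun lra ring zify.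
Import Order.TTheory GRing.Theory Num.Theory.
Import numFieldNormedType.Exports.
Set Implicit Arguments.
Unset Strict Implicit.
Unset Printing Implicit Defensive.
Local Open Scope ring_scope.

(** * Copies of a graph *)

(** As [n * y ^ m = 1], a union of two copies with [k] vertices and [e] edges contributes [n ^ k * t
    ^ e = z ^ e * y ^ (v * e - m * k)]. The exponent is a positive integer, hence at least 1: this
    scale turns the strict inequality of densities into a full factor [y], however small the gap.
    The obstacle is the dependence on [z]: for [z <= K] the error carries a factor [K ^ (2 * m)].
    The limit law does not suffer, since both sides decrease in [z] and are small at a large fixed
    [K]. The expectation does. If the scale of a block is written [s ^ (2 * m).+1], the error
    [z ^ (2 * m) * s ^ (2 * m).+1] is at most [s] while [z * s <= 1]; for larger [z] the bound at
    [1 / s] persists by monotonicity. The exponents in the tail bound come from this choice. The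
    weights lie in [0, 1] only almost surely, hence the null events set aside when a term is
    compared with a sum, or a weight with 1. *)

Section graph_copies.
Context (T U : finType).
Implicit Types (H : graph T) (G : graph U).

Lemma edges_sub_vertices (V : finType) (G : graph V) e :
  e \in edges G -> e \subset vertices G.
Proof. by move=> eG; have /forall_inP/(_ e eG)/andP[] := graph_valP G. Qed.

Lemma card_edge (V : finType) (G : graph V) e : e \in edges G -> #|e| = 2.
Proof. by move=> eG; have /forall_inP/(_ e eG)/andP[_ /eqP] := graph_valP G. Qed.

Lemma graph_eqP (V : finType) (G G' : graph V) :
  vertices G = vertices G' -> edges G = edges G' -> G = G'.
Proof.
move=> eV eE; apply: val_inj; move: eV eE; rewrite /vertices /edges /=.
by case: (graph_val G) (graph_val G') => V1 E1 [V2 E2] /= -> ->.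
Qed.

Definition graph_image H (f : T -> U) G : bool :=
  ([set f x | x in vertices H] == vertices G) &&
  ([set [set f x | x in e] | e : {set T} in edges H] == edges G).

Lemma isomorphicE H G : isomorphic H G <->
  exists2 f : T -> U, {in vertices H &, injective f} & graph_image H f G.
Proof.
split => [[f [injf eV eE]]|[f injf /andP[/eqP eV /eqP eE]]]; last by exists f.
by exists f => //; rewrite /graph_image eV eE !eqxx.
Qed.

Lemma imset_in_inj (A B B' : {set T}) (f : T -> U) :
  {in A &, injective f} -> B \subset A -> B' \subset A ->
  [set f x | x in B] = [set f x | x in B'] -> B = B'.
Proof.
move=> injf sB sB' eB; apply/eqP; rewrite finset.eqEsubset.
have sub (C C' : {set T}) : C \subset A -> C' \subset A ->
    [set f x | x in C] = [set f x | x in C'] -> C \subset C'.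
  move=> /fintype.subsetP sC /fintype.subsetP sC' e.
  apply/fintype.subsetP => x xC.
  have : f x \in [set f x | x in C'] by rewrite -e imset_f.
  by case/imsetP => y yC' /injf -> //; [exact: sC|exact: sC'].
by apply/andP; split; apply: sub.
Qed.

Lemma graph_image_exists H (f : T -> U) : {in vertices H &, injective f} ->
  exists G, graph_image H f G.
Proof.
move=> injf.
have valid : [forall e in [set [set f x | x in e] | e : {set T} in edges H],
    (e \subset [set f x | x in vertices H]) && (#|e| == 2)].
  apply/forall_inP => _ /imsetP[e eH ->].
  have sV := edges_sub_vertices eH; rewrite imsetS //=.
  rewrite card_in_imset ?(card_edge eH) // => x y xe ye.
  by apply: injf; exact: (fintype.subsetP sV).
by exists (Graph (graph_val := (_, _)) valid); rewrite /graph_image !eqxx.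
Qed.

Lemma graph_image_uniq H (f : T -> U) G G' :
  graph_image H f G -> graph_image H f G' -> G = G'.
Proof.
move=> /andP[/eqP eV /eqP eE] /andP[/eqP eV' /eqP eE'].
by apply: graph_eqP; rewrite -?eV -?eE ?eV' ?eE'.
Qed.

Lemma card_isomorphic_vertices H G : isomorphic H G ->
  #|vertices G| = #|vertices H|.
Proof. by case=> f [injf <- _]; rewrite card_in_imset. Qed.

Lemma card_isomorphic_edges H G : isomorphic H G -> #|edges G| = #|edges H|.
Proof.
case=> f [injf _ <-]; rewrite card_in_imset // => e e' eH e'H.
by apply: imset_in_inj injf _ _; exact: edges_sub_vertices.
Qed.

(** The vertex set [B] is a parameter because the tail bound works with copies inside disjoint
    blocks of vertices. *)
Definition copies H (B : {set U}) : {set graph U} :=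
  [set G | `[< isomorphic H G >] && (vertices G \subset B)].

Lemma copiesP H (B : {set U}) G : reflect (isomorphic H G /\ vertices G \subset B)
  (G \in copies H B).
Proof. by rewrite inE; apply: (iffP andP) => -[/asboolP]. Qed.

Lemma copiesS H (B B' : {set U}) : B \subset B' -> copies H B \subset copies H B'.
Proof.
move=> sB; apply/fintype.subsetP => G /copiesP[iG sG]; apply/copiesP.
by split => //; exact: fintype.subset_trans sB.
Qed.

(** * The number of copies, by counting embeddings *)

Section count.
Variables (H : graph T) (B : {set U}) (u0 : U).
Let V := vertices H.
Let VT := {x : T | x \in V}.

(* [u0] is a junk value outside the vertices of [H]. *)
Definition extend (f : VT -> U) (x : T) : U := oapp f u0 (insub x).

Lemma extend_val (f : VT -> U) (x : VT) : extend f (val x) = f x.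
Proof. by rewrite /extend valK. Qed.

Lemma extend_inj (f : VT -> U) : injective f -> {in V &, injective (extend f)}.
Proof.
move=> injf x y xV yV; rewrite -[x](SubK VT xV) -[y](SubK VT yV) !extend_val.
by move/injf ->.
Qed.

Lemma eq_graph_image (f g : T -> U) G : {in V, f =1 g} ->
  graph_image H f G = graph_image H g G.
Proof.
move=> fg; rewrite /graph_image; congr (_ && _); congr (_ == _).
  exact: eq_in_imset.
apply: eq_in_imset => e eH; apply: eq_in_imset => x xe; apply: fg.
exact: (fintype.subsetP (edges_sub_vertices eH)).
Qed.

Let injs : {set {ffun VT -> U}} := [set f in ffun_on (mem B) | injectiveb f].

Lemma automorphisms_comp (g : T -> U) (s : {perm T}) G :
  graph_image H g G -> s \in automorphisms H -> graph_image H (g \o s) G.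
Proof.
move=> /andP[/eqP gV /eqP gE]; rewrite inE => /andP[sV /eqP sE].
rewrite /graph_image (imset_comp g s) im_perm_on // gV eqxx /=.
rewrite -gE -[in X in _ == X]sE.
rewrite -(imset_comp (fun e : {set T} => g @: e) (fun e : {set T} => s @: e)).
by apply/eqP; apply: eq_in_imset => e eH /=; rewrite (imset_comp g s).
Qed.

(** Fix one embedding [g] of [H] with image [G]: the embeddings with image [G] are exactly the
    [g \o s] for [s] an automorphism, and distinct [s] give distinct maps on [V]. *)
Lemma card_fiber G : G \in copies H B ->
  #|[set f in injs | graph_image H (extend f) G]| = #|automorphisms H|.
Proof.
case/copiesP => /isomorphicE[g injg gG] sGB.
pose Phi (s : {perm T}) : {ffun VT -> U} := [ffun x => g (s (val x))].
have sVE s : s \in automorphisms H -> forall x, (s x \in V) = (x \in V).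
  by rewrite inE => /andP[sV _] x; exact: perm_closed.
have PhiE s : {in V, extend (Phi s) =1 g \o s}.
  by move=> x xV; rewrite -[x](SubK VT xV) extend_val ffunE.
have /andP[/eqP gV /eqP gE] := gG.
rewrite -(card_in_imset (f := Phi) (D := mem (automorphisms H))); last first.
  move=> s s' sA s'A /ffunP e; apply/permP => x.
  have [xV|xV] := boolP (x \in V).
    have := e (Sub x xV); rewrite !ffunE SubK => /injg.
    by rewrite !sVE // => ->.
  by move: sA s'A; rewrite !inE => /andP[/out_perm -> // _] /andP[/out_perm -> // _].
congr #|pred_of_set _|; apply/setP => f; apply/idP/imsetP => [|[s sA ->]]; last first.
  rewrite 2!inE (eq_graph_image _ (PhiE s)) automorphisms_comp // andbT.
  apply/andP; split.
    apply/ffun_onP => x; rewrite ffunE; apply: (fintype.subsetP sGB).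
    by rewrite -gV imset_f // sVE // (valP x).
  apply/injectiveP => x y; rewrite !ffunE => /injg.
  by rewrite !sVE // => /(_ (valP x) (valP y)) /perm_inj/val_inj.
rewrite 2!inE => /andP[/andP[fB /injectiveP injf]] /andP[/eqP fV /eqP fE].
(* The automorphism sought is the inverse of [g] after [f] on [V], and the identity elsewhere. For
   [x] in [V] the default of [odflt] is never reached. *)
pose s0 x := if x \in V then odflt x [pick y in V | g y == extend f x] else x.
have s0P x : x \in V -> s0 x \in V /\ g (s0 x) = extend f x.
  move=> xV; rewrite /s0 xV; case: pickP => [y /andP[yV /eqP]//|no].
  have : extend f x \in vertices G by rewrite -fV imset_f.
  rewrite -gV => /imsetP[y yV e].
  by have := no y; rewrite yV e eqxx.
have s0V x : (s0 x \in V) = (x \in V).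
  have [xV|xV] := boolP (x \in V); first by rewrite (s0P x xV).1.
  by rewrite /s0 !(negPf xV).
have injs0 : injective s0.
  move=> x y e; have [xV|xV] := boolP (x \in V).
    have yV : y \in V by rewrite -s0V -e s0V.
    by apply: (extend_inj injf) => //; rewrite -(s0P x xV).2 -(s0P y yV).2 e.
  have yV : y \notin V by rewrite -s0V -e s0V.
  by move: e; rewrite /s0 (negPf xV) (negPf yV).
exists (perm injs0); last first.
  by apply/ffunP => x; rewrite ffunE permE (s0P _ (valP x)).2 extend_val.
rewrite inE; apply/andP; split.
  apply/fintype.subsetP => x; rewrite inE permE; apply: contraR => xV.
  by rewrite /s0 (negPf xV).
have imP e : e \in edges H -> [set g x | x in [set perm injs0 x | x in e]] =
    [set extend f x | x in e].
  move=> eH; rewrite -imset_comp; apply: eq_in_imset => x xe /=.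
  by rewrite permE (s0P x _).2 // (fintype.subsetP (edges_sub_vertices eH)).
(* Both edge sets have the same cardinality, so one inclusion is enough. *)
rewrite eqEcard card_imset ?leqnn ?andbT; last exact: imset_inj perm_inj.
apply/fintype.subsetP => _ /imsetP[e eH ->].
have : [set extend f x | x in e] \in edges G by rewrite -fE imset_f.
rewrite -gE => /imsetP[e' e'H]; rewrite -imP // => ee'.
rewrite (imset_in_inj injg _ _ ee') //; last exact: edges_sub_vertices.
apply/fintype.subsetP => _ /imsetP[x xe ->]; rewrite permE s0V.
exact: (fintype.subsetP (edges_sub_vertices eH)).
Qed.

(** Double counting of the pairs formed by an injection of [V] into [B] and its image: each
    injection has exactly one image, and each copy is the image of as many injections as there are
    automorphisms. *)
Lemma card_copies : (#|copies H B| * #|automorphisms H| = #|B| ^_ #|V|)%N.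
Proof.
have -> : #|V| = #|{: VT}| by rewrite card_sig; apply: eq_card => x; rewrite !inE.
rewrite -(card_inj_ffuns_on VT (mem B)) -/injs -sum_nat_const.
rewrite (eq_bigr (fun G => #|[set f in injs | graph_image H (extend f) G]|)); last first.
  by move=> G /card_fiber.
under eq_bigr => G _ do rewrite -sum1_card.
rewrite (exchange_big_dep (mem injs)) /=; last by move=> G f _; rewrite inE => /andP[].
rewrite -[RHS]sum1_card; apply: eq_bigr => f finj.
have /andP[/ffun_onP fB /injectiveP injf] : (f \in ffun_on (mem B)) && injectiveb f.
  by move: finj; rewrite inE.
have [G fG] := graph_image_exists (extend_inj injf).
rewrite (big_pred1 G) // => G'; rewrite [f \in _]inE finj /=.
apply/andP/eqP => [[_ fG']|->]; first exact: graph_image_uniq fG' fG.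
split=> //; apply/copiesP; split.
  by apply/isomorphicE; exists (extend f) => //; exact: extend_inj.
have /andP[/eqP <- _] := fG; apply/fintype.subsetP => _ /imsetP[x xV ->].
by rewrite -[x](SubK VT xV) extend_val; exact: fB.
Qed.

End count.

Lemma strictly_balanced_card H (H' : graph T) : strictly_balanced H ->
  subgraph H' H -> H' != H -> vertices H' != finset.set0 ->
  (#|edges H'| * #|vertices H| < #|edges H| * #|vertices H'|)%N.
Proof.
move=> balH sub neq nz; have := balH _ sub neq nz.
have v'0 : (0 < #|vertices H'|)%N by rewrite card_gt0.
have v0 : (0 < #|vertices H|)%N.
  by rewrite (leq_trans v'0) //; apply: subset_leq_card; case/andP: sub.
by rewrite /den ltr_pdivrMr ?ltr0n // mulrAC ltr_pdivlMr ?ltr0n // -!natrM ltr_nat.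
Qed.

(** The intersection of the two copies pulls back through the isomorphism [f] onto [G2] to a proper
    subgraph [H'] of [H], so it is less dense than [H]. By inclusion-exclusion on vertices and on
    edges, the union is then denser than [H]. *)
Lemma copies_density H G1 G2 : strictly_balanced H ->
  isomorphic H G1 -> isomorphic H G2 -> G1 != G2 ->
  vertices G1 :&: vertices G2 != finset.set0 ->
  (#|edges H| * #|vertices G1 :|: vertices G2| <
   #|vertices H| * #|edges G1 :|: edges G2|)%N.
Proof.
move=> balH iso1 iso2 neq nz.
have [v1 v2] := (card_isomorphic_vertices iso1, card_isomorphic_vertices iso2).
have [e1 e2] := (card_isomorphic_edges iso1, card_isomorphic_edges iso2).
have [f [injf fV fE]] := iso2.
pose V' := [set x in vertices H | f x \in vertices G1].
pose E' := [set e : {set T} in edges H | [set f x | x in e] \in edges G1].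
have valid : [forall e in E', (e \subset V') && (#|e| == 2)].
  apply/forall_inP => e; rewrite inE => /andP[eH feG].
  rewrite (card_edge eH) eqxx andbT; apply/fintype.subsetP => x xe.
  rewrite inE (fintype.subsetP (edges_sub_vertices eH)) //=.
  by apply: (fintype.subsetP (edges_sub_vertices feG)); exact: imset_f.
pose H' := Graph (graph_val := (V', E')) valid.
have fV' : [set f x | x in V'] = vertices G1 :&: vertices G2.
  apply/setP => u; rewrite inE -fV; apply/imsetP/andP => [[x]|[uG /imsetP[x xH ux]]].
    by rewrite inE => /andP[xH fx] ->; rewrite fx imset_f.
  by exists x => //; rewrite inE xH -ux.
have fE' : [set [set f x | x in e] | e : {set T} in E'] = edges G1 :&: edges G2.
  apply/setP => u; rewrite inE -fE; apply/imsetP/andP => [[e]|[uG /imsetP[e eH ue]]].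
    by rewrite inE => /andP[eH fe] ->; rewrite fe imset_f.
  by exists e => //; rewrite inE eH -ue.
have cV' : #|V'| = #|vertices G1 :&: vertices G2|.
  rewrite -fV' card_in_imset // => x y; rewrite !inE => /andP[xH _] /andP[yH _].
  exact: injf.
have cE' : #|E'| = #|edges G1 :&: edges G2|.
  rewrite -fE' card_in_imset // => x y; rewrite !inE => /andP[xH _] /andP[yH _].
  by apply: imset_in_inj injf _ _; exact: edges_sub_vertices.
have sub : subgraph H' H.
  apply/andP; split; apply/fintype.subsetP => x; rewrite /vertices /edges /= inE;
    by case/andP.
(* If [H'] were all of [H], the intersection would exhaust both copies, which would coincide. *)
have neqH : H' != H.
  apply: contra neq => /eqP HH.
  have cV : #|vertices H| = #|V'| by rewrite -HH.
  have cE : #|edges H| = #|E'| by rewrite -HH.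
  apply/eqP/graph_eqP; apply/eqP.
    rewrite eq_sym eqEcard v1 v2 leqnn andbT.
    apply/finset.setIidPr/eqP; rewrite eqEcard finset.subsetIr /=.
    by rewrite v2 cV cV'.
  rewrite eq_sym eqEcard e1 e2 leqnn andbT.
  apply/finset.setIidPr/eqP; rewrite eqEcard finset.subsetIr /=.
  by rewrite e2 cE cE'.
have nz' : vertices H' != finset.set0.
  by rewrite -card_gt0 /vertices /= cV' card_gt0.
have lt : (#|edges G1 :&: edges G2| * #|vertices H| <
    #|edges H| * #|vertices G1 :&: vertices G2|)%N.
  by rewrite -cV' -cE'; exact: (strictly_balanced_card balH sub neqH nz').
have := cardsUI (vertices G1) (vertices G2); have := cardsUI (edges G1) (edges G2).
rewrite v1 v2 e1 e2 => /(congr1 (muln #|vertices H|)) hE.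
move=> /(congr1 (muln #|edges H|)) hV.
rewrite !mulnDr in hE hV; rewrite mulnC in lt.
by move: hE hV lt; rewrite [(#|vertices H| * #|edges H|)%N]mulnC; lia.
Qed.

End graph_copies.

(** * Counting bounds and the sum over overlapping pairs *)

Lemma ffact_le_exp n k : (n ^_ k <= n ^ k)%N.
Proof.
elim: k => [|k IH]; first by rewrite ffactn0.
by rewrite ffactnSr expnSr leq_mul // leq_subr.
Qed.

Lemma bin_le_exp n k : ('C(n, k) <= n ^ k)%N.
Proof.
apply: leq_trans (ffact_le_exp n k).
by rewrite -bin_ffact leq_pmulr // fact_gt0.
Qed.

(** For each of the [K] possible sizes [k], the sets of size [k] contribute at most
    [(#|B| * y) ^ k <= 1]. *)
Lemma sum_small_sets (R : realFieldType) (U : finType) (B : {set U}) (y : R)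
    (K : nat) : 0 <= y -> #|B|%:R * y <= 1 ->
  \sum_(A : {set U} | (A \subset B) && (#|A| < K)%N) y ^+ #|A| <= K%:R.
Proof.
move=> y0 yB; case: K => [|K].
  by rewrite big1 // => A; rewrite ltn0 andbF.
rewrite (partition_big (fun A : {set U} => inord #|A| : 'I_K.+1) xpredT) //=.
apply: (@le_trans _ _ (\sum_(k < K.+1) 1)); last by rewrite sumr_const card_ord.
apply: ler_sum => k _.
apply: (@le_trans _ _ (\sum_(A in [set A : {set U} | (A \subset B) & #|A| == k]) y ^+ k)).
  rewrite big_mkcond [leRHS]big_mkcond /=; apply: ler_sum => A _; rewrite inE.
  case: ifP => [/andP[/andP[sA AK] /eqP ek]|_]; last by case: ifP => // _; exact: exprn_ge0.
  have -> : #|A| = k :> nat by rewrite -ek inordK.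
  by rewrite eqxx sA.
rewrite sumr_const cards_draws -mulr_natl.
apply: (@le_trans _ _ ((#|B|%:R * y) ^+ k)).
  rewrite exprMn -natrX ler_wpM2r ?exprn_ge0 // ler_nat; exact: bin_le_exp.
by rewrite exprn_ile1 // mulr_ge0.
Qed.

Lemma card_graphs_on (U : finType) (A : {set U}) :
  (#|[set G : graph U | vertices G \subset A]| <= 2 ^ #|A| * 2 ^ (2 ^ #|A|))%N.
Proof.
rewrite -!card_powerset -cardsX -(card_imset _ val_inj); apply: subset_leq_card.
apply/fintype.subsetP => _ /imsetP[G + ->]; rewrite inE => sG.
rewrite inE; apply/andP; split; first by rewrite powersetE.
rewrite powersetE; apply/fintype.subsetP => e eG; rewrite powersetE.
by apply: fintype.subset_trans sG; exact: edges_sub_vertices.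
Qed.

(* Bounds the number of pairs of graphs on a common set of [k] vertices. *)
Definition pair_count (k : nat) : nat := ((2 ^ k * 2 ^ (2 ^ k)) ^ 2)%N.

(** Each pair is charged to the union [A] of its vertex sets. Its term is at most
    [K ^ (2 * m) * y * (y ^ m) ^ #|A|], at most [pair_count (2 * v)] pairs have the same [A], and
    the sum over [A] is bounded size by size, with sizes from 0 to [2 * v]. *)
Lemma copies_pair_sum (R : realFieldType) (T U : finType) (H : graph T)
    (B : {set U}) (z y K : R) :
  strictly_balanced H -> 0 <= z <= K -> 1 <= K -> 0 <= y <= 1 ->
  #|B|%:R * y ^+ #|edges H| <= 1 ->
  \sum_(G in copies H B)
    \sum_(G' in copies H B | (G' != G) && ~~ [disjoint edges G & edges G'])
      (z * y ^+ #|vertices H|) ^+ #|edges G :|: edges G'| <=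
  (pair_count (2 * #|vertices H|) * (2 * #|vertices H|).+1)%:R *
    K ^+ (2 * #|edges H|) * y.
Proof.
set m := #|edges H|; set v := #|vertices H|.
move=> balH /andP[z0 zK] K1 /andP[y0 y1] yB.
have K0 : 0 <= K by exact: le_trans K1.
pose U2 (p : graph U * graph U) := vertices p.1 :|: vertices p.2.
pose small (A : {set U}) := (A \subset B) && (#|A| < (2 * v).+1)%N.
rewrite pair_big_dep /=.
pose c := K ^+ (2 * m) * y.
have c0 : 0 <= c by rewrite mulr_ge0 ?exprn_ge0.
apply: (@le_trans _ _ (\sum_(p in finset.setX (copies H B) (copies H B))
    c * (y ^+ m) ^+ #|U2 p|)).
  rewrite big_mkcond [leRHS]big_mkcond /=; apply: ler_sum => -[G G'] _ /=.
  rewrite finset.in_setX /=; have [GC|_] := boolP (G \in copies H B) => //=.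
  have [GC'|_] := boolP (G' \in copies H B) => //=.
  case: ifP => [/andP[neq]|_]; last by rewrite mulr_ge0 // !exprn_ge0.
  move=> /pred0Pn[e /= /andP[eG eG']].
  have /copiesP[iG _] := GC; have /copiesP[iG' _] := GC'.
  have nz : vertices G :&: vertices G' != finset.set0.
    have /card_gt0P[x xe] : (0 < #|e|)%N by rewrite (card_edge eG).
    apply/finset.set0Pn; exists x; rewrite inE.
    by rewrite !(fintype.subsetP (edges_sub_vertices _) x xe).
  rewrite eq_sym in neq.
  have := copies_density balH iG iG' neq nz; rewrite -/m -/v => dens.
  have e2m : (#|edges G :|: edges G'| <= 2 * m)%N.
    rewrite (leq_trans (leq_card_setU _ _)) //.
    by rewrite (card_isomorphic_edges iG) (card_isomorphic_edges iG') mul2n addnn.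
  rewrite exprMn -exprM /c -mulrA ler_pM ?exprn_ge0 //.
    apply: (@le_trans _ _ (K ^+ #|edges G :|: edges G'|)); first exact: lerXn2r.
    exact: ler_weXn2l.
  (* Strict balancedness enters here: [m * k + 1 <= v * e] holds between integers, and the extra 1
     is the factor [y] of the conclusion. *)
  by rewrite -exprM -exprS; exact: ler_wiXn2l.
rewrite (partition_big U2 small) /=; last first.
  move=> [G G']; rewrite finset.in_setX /= => /andP[/copiesP[iG sG] /copiesP[iG' sG']].
  rewrite /small /U2 /= finset.subUset sG sG' /= ltnS (leq_trans (leq_card_setU _ _)) //.
  by rewrite (card_isomorphic_vertices iG) (card_isomorphic_vertices iG') mul2n addnn.
apply: (@le_trans _ _ (\sum_(A | small A) (pair_count (2 * v))%:R * c * (y ^+ m) ^+ #|A|)).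
  apply: ler_sum => A /andP[_ sA].
  apply: (@le_trans _ _ (\sum_(p in finset.setX [set G : graph U | vertices G \subset A]
     [set G : graph U | vertices G \subset A]) c * (y ^+ m) ^+ #|A|)).
    rewrite big_mkcond [leRHS]big_mkcond /=; apply: ler_sum => -[G G'] _.
    case: ifP => [/andP[_ /eqP eA]|_]; last first.
      by case: ifP => // _; rewrite mulr_ge0 // !exprn_ge0.
    by rewrite !inE /= -eA finset.subsetUl finset.subsetUr.
  rewrite sumr_const -[leLHS]mulr_natl -[leRHS]mulrA; apply: ler_wpM2r.
    by rewrite mulr_ge0 // !exprn_ge0.
  rewrite ler_nat cardsX /pair_count -mulnn.
  have le_cnt : (#|[set G : graph U | vertices G \subset A]| <=
      2 ^ (2 * v) * 2 ^ (2 ^ (2 * v)))%N.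
    rewrite (leq_trans (card_graphs_on A)) // leq_mul // leq_pexp2l // leq_pexp2l //.
  by rewrite leq_mul.
rewrite -mulr_sumr.
have -> : (pair_count (2 * v) * (2 * v).+1)%:R * K ^+ (2 * m) * y =
    (pair_count (2 * v))%:R * c * (2 * v).+1%:R.
  by rewrite natrM /c -!mulrA; congr (_ * _); rewrite mulrC -mulrA.
apply: ler_wpM2l; first by rewrite mulr_ge0.
by apply: sum_small_sets => //; exact: exprn_ge0.
Qed.

Local Open Scope classical_set_scope.
Local Open Scope ring_scope.

(** * Independence and sums of uniform variables *)

Section independent_blocks.
Context (R : realType) (d : measure_display) (Omega : measurableType d).
Variable P : probability Omega R.

(** For fixed [C], both sides are finite measures in [A]: the restriction of [P] to [C], and [P]
    scaled by [P C]. They agree on a generating family stable under intersection, hence on the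
    sigma-algebra. *)
Lemma indep_sigma_algebra (G : set (set Omega)) (C : set Omega) :
  measurable C -> G `<=` measurable -> setI_closed G -> G setT ->
  (forall A, G A -> P (A `&` C) = (P A * P C)%E) ->
  forall A, <<s G >> A -> P (A `&` C) = (P A * P C)%E.
Proof.
move=> mC mG IG GT indG A GA.
have c0 : (0 <= fine (P C))%R by rewrite fine_ge0.
have PCfin : P C \is a fin_num by rewrite fin_num_measure.
have -> : P (A `&` C) = mrestr P mC A by [].
have eqm D : (P D * P C)%E = mscale (NngNum c0) P D.
  by rewrite /mscale /= fineK // muleC.
rewrite eqm.
apply: (g_sigma_algebra_measure_unique G mG (fun=> setT) (fun=> GT)) GA => //.
- by rewrite bigcup_const //; exists 0%N.
- by move=> B GB; exact: etrans (indG B GB) (eqm B).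
- move=> _; apply: (@le_lt_trans _ _ 1%E); last by rewrite ltry.
  by apply: probability_le1; exact: measurableI.
Qed.

Variables (I : finType) (X : I -> {RV P >-> R}).

(** A generating family, stable under intersection, of the sigma-algebra of the [X i] for [i] in
    [B]. Mutual independence speaks directly about these events. *)
Definition cylinders (B : {set I}) : set (set Omega) :=
  [set C | exists2 S : I -> set R, (forall i, measurable (S i)) &
    C = \bigcap_(i in [set` B]) (X i @^-1` S i)].

Lemma cylinders_setI B : setI_closed (cylinders B).
Proof.
move=> _ _ [S mS ->] [S' mS' ->]; exists (fun i => S i `&` S' i).
  by move=> i; exact: measurableI.
by rewrite -bigcapI.
Qed.

Lemma cylinders_setT B : cylinders B setT.
Proof.
exists (fun=> setT) => //; apply/esym; rewrite -subTset => x _ i _ //=.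
Qed.

Lemma measurable_preim_RV i (S : set R) : measurable S -> measurable (X i @^-1` S).
Proof. by move=> mS; rewrite -[_ @^-1` _]setTI; exact: measurable_funP. Qed.

Lemma cylinders_measurable B : cylinders B `<=` measurable.
Proof.
move=> _ [S mS ->]; apply: fin_bigcap_measurable => // i _.
exact: measurable_preim_RV.
Qed.

Lemma sigma_cylinders_measurable B : <<s cylinders B >> `<=` measurable.
Proof.
apply: smallest_sub; first exact: sigma_algebra_measurable.
exact: cylinders_measurable.
Qed.

Variable A0 : {set I}.
Hypothesis indep : mutually_independent A0 X.

(** The product formula for two cylinders is extended to one sigma-algebra at a time, the event of
    the other side being held fixed. *)
Lemma indep_sigma_cylinders (A B : {set I}) (E F : set Omega) :
  A \subset A0 -> B \subset A0 -> [disjoint A & B]%bool ->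
  <<s cylinders A >> E -> <<s cylinders B >> F ->
  P (E `&` F) = (P E * P F)%E.
Proof.
move=> sA sB dAB sE sF.
apply: (indep_sigma_algebra (G := cylinders A)) sE.
- exact: sigma_cylinders_measurable sF.
- exact: cylinders_measurable.
- exact: cylinders_setI.
- exact: cylinders_setT.
move=> _ [S mS ->]; rewrite setIC muleC.
apply: (indep_sigma_algebra (G := cylinders B)) sF.
- by apply: cylinders_measurable; exists S.
- exact: cylinders_measurable.
- exact: cylinders_setI.
- exact: cylinders_setT.
move=> _ [S' mS' ->].
(* As [A] and [B] are disjoint, the intersection of the two cylinders is a single cylinder over
   their union. *)
pose SS i := if i \in A then S i else S' i.
have mSS i : measurable (SS i) by rewrite /SS; case: ifP.
have eA i : i \in A -> SS i = S i by rewrite /SS => ->.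
have eB i : i \in B -> SS i = S' i.
  by move=> iB; rewrite /SS ifN // (disjointFl dAB iB).
have -> : \bigcap_(i in [set` B]) (X i @^-1` S' i) `&`
    \bigcap_(i in [set` A]) (X i @^-1` S i) =
    \bigcap_(i in [set` (A :|: B)%SET]) (X i @^-1` SS i).
  apply/seteqP; split => [x [/= HB HA] i /=|x /= H].
    rewrite finset.in_setU => /orP[iA|iB].
      by rewrite eA //; exact: HA.
    by rewrite eB //; exact: HB.
  split=> i /= iX.
    by have := H i; rewrite /= finset.in_setU iX orbT eB //; exact.
  by have := H i; rewrite /= finset.in_setU iX eA //; exact.
rewrite !indep //; last by rewrite finset.subUset sA.
rewrite (eq_bigl [predU A & B]); last by move=> i; rewrite !inE.
rewrite bigU //= muleC; congr (_ * _)%E; apply: eq_bigr => i iX.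
  by rewrite eB.
by rewrite eA.
Qed.

Lemma measurable_cylinders_RV (B : {set I}) i : i \in B ->
  measurable_fun (setT : set (g_sigma_algebraType (cylinders B))) (X i).
Proof.
move=> iB _ S mS; rewrite setTI; apply: sub_sigma_algebra.
exists (fun j => if j == i then S else setT); first by move=> j; case: ifP.
apply/seteqP; split=> x /= Hx.
  by move=> j _ /=; case: eqP => // ->.
by have := Hx i iB; rewrite /= eqxx.
Qed.

Lemma sigma_cylinders_sum_lt (B D : {set I}) (t : R) : D \subset B ->
  <<s cylinders B >> [set x | \sum_(i in D) X i x < t].
Proof.
move=> /fintype.subsetP sDB.
have mX i : i \in enum D ->
    measurable_fun (setT : set (g_sigma_algebraType (cylinders B))) (X i).
  by rewrite mem_enum => /sDB; exact: measurable_cylinders_RV.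
have -> : [set x | \sum_(i in D) X i x < t] =
   (fun x => \sum_(i <- enum D) X i x) @^-1` `]-oo, t[%classic.
  by apply/seteqP; split => x /=; rewrite in_itv /= big_enum.
have : measurable_fun (setT : set (g_sigma_algebraType (cylinders B)))
    (fun x => \sum_(i <- enum D) X i x).
  elim: (enum D) mX => [|i s IH] mX.
    by under eq_fun do rewrite big_nil; exact: measurable_cst.
  under eq_fun do rewrite big_cons; apply: measurable_funD.
    by apply: mX; rewrite inE eqxx.
  by apply: IH => j js; apply: mX; rewrite inE js orbT.
by move=> /(_ measurableT `]-oo, t[%classic (measurable_itv _)); rewrite setTI.
Qed.

End independent_blocks.

Section real_probability.
Context (R : realType) (d : measure_display) (Omega : measurableType d).
Variable P : probability Omega R.
Implicit Types A B : set Omega.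

Definition prob A : R := fine (P A).

Lemma prob_ge0 A : 0 <= prob A.
Proof. exact: fine_ge0. Qed.

Lemma probE A : measurable A -> P A = (prob A)%:E.
Proof. by move=> mA; rewrite /prob fineK // fin_num_measure. Qed.

Lemma prob_setT : prob setT = 1.
Proof. by rewrite /prob probability_setT. Qed.

Lemma prob_set0 : prob set0 = 0.
Proof. by rewrite /prob measure0. Qed.

Lemma le_prob A B : measurable A -> measurable B -> A `<=` B -> prob A <= prob B.
Proof.
move=> mA mB sAB; rewrite -lee_fin -!probE //.
by apply: le_measure; rewrite ?inE.
Qed.

Lemma prob_le1 A : measurable A -> prob A <= 1.
Proof. by move=> mA; rewrite -prob_setT; apply: le_prob. Qed.

Lemma prob_setU A B : measurable A -> measurable B -> A `&` B = set0 ->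
  prob (A `|` B) = prob A + prob B.
Proof.
move=> mA mB AB0; apply: EFin_inj; rewrite EFinD -!probE //; last first.
  exact: measurableU.
by rewrite measureU.
Qed.

Lemma prob_setU_le A B : measurable A -> measurable B ->
  prob (A `|` B) <= prob A + prob B.
Proof.
move=> mA mB; rewrite -lee_fin EFinD -!probE //; last exact: measurableU.
exact: measureU2.
Qed.

Lemma prob_setU0 A B : measurable A -> measurable B -> prob B = 0 ->
  prob (A `|` B) = prob A.
Proof.
move=> mA mB B0; apply/eqP; rewrite eq_le; apply/andP; split.
  by have := prob_setU_le mA mB; rewrite B0 addr0.
by apply: le_prob => //; exact: measurableU.
Qed.

Lemma prob_bigsetU0 (I : eqType) (s : seq I) (A : I -> set Omega) :
  (forall i, measurable (A i)) -> (forall i, i \in s -> prob (A i) = 0) ->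
  prob (\big[setU/set0]_(i <- s) A i) = 0.
Proof.
move=> mA; elim: s => [|i s IH] A0; first by rewrite big_nil prob_set0.
rewrite big_cons setUC prob_setU0 //.
- by apply: IH => j js; apply: A0; rewrite inE js orbT.
- by apply: bigsetU_measurable => j _; exact: mA.
- by apply: A0; rewrite inE eqxx.
Qed.

Lemma prob_fibers (T : choiceType) (s : seq T) (f : Omega -> T) A :
  uniq s -> (forall z, measurable [set x | f x = z]) -> measurable A ->
  prob (A `&` [set x | f x \in s]) = \sum_(z <- s) prob (A `&` [set x | f x = z]).
Proof.
move=> + mf mA; elim: s => [|z s IH] /=.
  move=> _; rewrite big_nil (_ : _ `&` _ = set0) ?prob_set0 //.
  by apply/seteqP; split => // x [].
move=> /andP[zs us]; rewrite big_cons -IH //.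
have mfs : measurable [set x | f x \in s].
  rewrite (_ : mkset _ = \big[setU/set0]_(z <- s) [set x | f x = z]).
    by apply: bigsetU_measurable => y _; exact: mf.
  rewrite -bigcup_seq; apply/seteqP; split => x /=.
    by move=> fs; exists (f x).
  by case=> y /= ys ->.
rewrite -prob_setU; last 3 first.
- exact: measurableI.
- exact: measurableI.
- apply/seteqP; split => // x [[_ /= fz] [_ /=]].
  by rewrite fz => zs'; rewrite zs' in zs.
congr (prob _); rewrite -setIUr; congr (_ `&` _); apply/seteqP; split => x /=.
  by rewrite inE => /orP[/eqP|]; [left|right].
by case=> [->|fs]; rewrite inE ?eqxx // fs orbT.
Qed.

Variables (I : finType) (X : I -> {RV P >-> R}) (A0 : {set I}).
Hypothesis indep : mutually_independent A0 X.
Hypothesis unif : forall i, i \in A0 -> uniform01 (X i).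

Lemma prob_indep (A B : {set I}) (E F : set Omega) :
  A \subset A0 -> B \subset A0 -> [disjoint A & B]%bool ->
  <<s cylinders X A >> E -> <<s cylinders X B >> F ->
  prob (E `&` F) = prob E * prob F.
Proof.
move=> sA sB dAB sE sF.
have mE := sigma_cylinders_measurable sE.
have mF := sigma_cylinders_measurable sF.
apply: EFin_inj; rewrite EFinM -!probE //; last exact: measurableI.
exact: (indep_sigma_cylinders indep sA sB).
Qed.

Lemma prob_uniform (i : I) (S : set R) : i \in A0 -> measurable S ->
  prob (X i @^-1` S) = fine (lebesgue_measure (S `&` `[0, 1])).
Proof.
move=> iA mS; rewrite /prob; congr fine.
have -> : P (X i @^-1` S) = distribution P (X i) S by [].
rewrite (unif iA mS) /uniform_prob integral_uniform_pdf.
rewrite (eq_integral (cst 1%E)) => [|x]; last first.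
  by rewrite inE => -[_ /=]; rewrite in_itv /uniform_pdf /= => ->; rewrite subr0 invr1.
by rewrite integral_cst ?mul1e //; exact: measurableI.
Qed.

Lemma prob_uniform_itv (i : I) (a b : R) : i \in A0 -> 0 <= a -> a <= b -> b <= 1 ->
  prob [set x | a <= X i x < b] = b - a.
Proof.
move=> iA a0 ab b1.
rewrite (_ : [set x | _] = X i @^-1` `[a, b[%classic); last first.
  by apply/seteqP; split => x /=; rewrite in_itv.
rewrite prob_uniform // (_ : _ `&` _ = `[a, b[%classic); last first.
  apply/seteqP; split => x /=; rewrite !in_itv /=; first by case.
  move=> /andP[ax xb]; split; rewrite ?ax ?xb //.
  by rewrite (le_trans a0 ax) (le_trans (ltW xb) b1).
rewrite lebesgue_measure_itv /= lte_fin; case: ltP => //= ba.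
by apply/eqP; rewrite eq_sym subr_eq0 eq_le ba ab.
Qed.

Lemma prob_uniform_lt0 (i : I) : i \in A0 -> prob [set x | X i x < 0] = 0.
Proof.
move=> iA.
rewrite (_ : [set x | _] = X i @^-1` `]-oo, 0[%classic); last first.
  by apply/seteqP; split => x /=; rewrite in_itv.
rewrite prob_uniform // (_ : _ `&` _ = set0) ?measure0 //.
apply/seteqP; split => // x /=; rewrite !in_itv /= => -[x0 /andP[]].
by rewrite leNgt x0.
Qed.

Lemma prob_uniform_gt1 (i : I) : i \in A0 -> prob [set x | 1 < X i x] = 0.
Proof.
move=> iA.
rewrite (_ : [set x | _] = X i @^-1` `]1, +oo[%classic); last first.
  by apply/seteqP; split => x /=; rewrite in_itv /= andbT.
rewrite prob_uniform // (_ : _ `&` _ = set0) ?measure0 //.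
apply/seteqP; split => // x /=; rewrite !in_itv /= andbT => -[x0 /andP[_]].
by rewrite leNgt x0.
Qed.

Lemma prob_uniform_lt (i : I) (t : R) : i \in A0 -> 0 <= t <= 1 ->
  prob [set x | X i x < t] = t.
Proof.
move=> iA /andP[t0 t1].
rewrite (_ : mkset _ = [set x | 0 <= X i x < t] `|` [set x | X i x < 0]); last first.
  apply/seteqP; split => x /=; first by move=> ->; case: (leP 0 (X i x)); [left|right].
  by case=> [/andP[]//|/lt_le_trans]; exact.
have m1 : measurable [set x | 0 <= X i x < t].
  rewrite (_ : mkset _ = X i @^-1` `[0, t[%classic).
    exact: measurable_preim_RV.
  by apply/seteqP; split => x /=; rewrite in_itv.
have m2 : measurable [set x | X i x < 0].
  rewrite (_ : mkset _ = X i @^-1` `]-oo, 0[%classic).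
    exact: measurable_preim_RV.
  by apply/seteqP; split => x /=; rewrite in_itv.
rewrite prob_setU0 ?prob_uniform_lt0 //.
by rewrite prob_uniform_itv // subr0.
Qed.

End real_probability.

(** The increment of the power [k.+1] lies between the values of its derivative at the two ends: a
    discrete mean value bound, which makes Riemann sums telescope. *)
Lemma succX_sub_bounds (R : realDomainType) (k n : nat) :
  (k.+1%:R * n%:R ^+ k <= n.+1%:R ^+ k.+1 - n%:R ^+ k.+1 :> R) /\
  (n.+1%:R ^+ k.+1 - n%:R ^+ k.+1 <= k.+1%:R * n.+1%:R ^+ k :> R).
Proof.
have n0 : 0 <= n%:R :> R by [].
have e : n.+1%:R = n%:R + 1 :> R by rewrite -natr1.
elim: k => [|k [IH1 IH2]].
  by rewrite !expr1 !expr0 !mulr1 e; split; lra.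
have le_pow : n%:R ^+ k.+1 <= n.+1%:R ^+ k.+1 :> R.
  by apply: lerXn2r; rewrite ?nnegrE // ler_nat.
set x := n.+1%:R in IH1 IH2 e le_pow *; set y := n%:R in IH1 IH2 e le_pow n0 *.
have -> : x ^+ k.+2 - y ^+ k.+2 = x * (x ^+ k.+1 - y ^+ k.+1) + y ^+ k.+1.
  by rewrite [x ^+ k.+2]exprS [y ^+ k.+2]exprS e; ring.
have -> : k.+2%:R = k.+1%:R + 1 :> R by rewrite natr1.
have x0 : 0 <= x by [].
split.
  have h := ler_wpM2l x0 IH1.
  have h' : 0 <= k.+1%:R * y ^+ k by rewrite mulr_ge0 ?exprn_ge0.
  rewrite mulrDl mul1r lerD2r (le_trans _ h) // exprS.
  rewrite e; nra.
have h := ler_wpM2l x0 IH2.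
by rewrite mulrDl mul1r lerD // (le_trans h) // [x ^+ k.+1]exprS mulrCA.
Qed.

(** * The law near 0 of a sum of independent uniform variables *)

Section irwin_hall.
Context (R : realType) (d : measure_display) (Omega : measurableType d).
Context (P : probability Omega R) (I : finType) (X : I -> {RV P >-> R}).
Variable A0 : {set I}.
Hypothesis indep : mutually_independent A0 X.
Hypothesis unif : forall i, i \in A0 -> uniform01 (X i).

Lemma measurable_sum_lt (D : {set I}) (t : R) :
  measurable [set x | \sum_(i in D) X i x < t].
Proof.
by apply: (@sigma_cylinders_measurable _ _ _ P _ X D); exact: sigma_cylinders_sum_lt.
Qed.

Lemma measurable_RV_lt i (t : R) : measurable [set x | X i x < t].
Proof.
rewrite (_ : mkset _ = X i @^-1` `]-oo, t[%classic).
  exact: measurable_preim_RV.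
by apply/seteqP; split => x /=; rewrite in_itv.
Qed.

Lemma sigma_cylinders_RV (D : {set I}) i (S : set R) : i \in D -> measurable S ->
  <<s cylinders X D >> (X i @^-1` S).
Proof.
move=> iD mS; have := measurable_cylinders_RV (X := X) iD measurableT mS.
by rewrite setTI.
Qed.

Lemma measurable_RV_itv i (a b : R) : measurable [set x | a <= X i x < b].
Proof.
rewrite (_ : mkset _ = X i @^-1` `[a, b[%classic).
  exact: measurable_preim_RV.
by apply/seteqP; split => x /=; rewrite in_itv.
Qed.

(* [X i] is sliced into [M.+1] intervals of length [t / M.+1]; on each of them the
   conditional law of the remaining sum is known up to the slice, and the errors
   telescope. *)
Lemma prob_sum_lt_step (i : I) (D : {set I}) (k : nat) (t : R) (M : nat) :
  i \in A0 -> D \subset A0 -> i \notin D -> 0 <= t <= 1 ->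
  (forall s, 0 <= s <= 1 ->
     prob P [set x | \sum_(j in D) X j x < s] = s ^+ k.+1 / k.+1`!%:R) ->
  `|prob P [set x | \sum_(j in i |: D) X j x < t] - t ^+ k.+2 / k.+2`!%:R|
    <= M.+1%:R^-1.
Proof.
move=> iA sD iD /andP[t0 t1] HF.
pose N : R := M.+1%:R.
have N0 : 0 < N by rewrite ltr0n.
pose S x := \sum_(j in D) X j x.
pose E := [set x | X i x + S x < t].
have mE : measurable E.
  rewrite (_ : E = [set x | \sum_(j in i |: D) X j x < t]).
    exact: measurable_sum_lt.
  by apply/seteqP; split => x; rewrite /E /S /= big_setU1.
have -> : [set x | \sum_(j in i |: D) X j x < t] = E.
  by apply/seteqP; split => x; rewrite /E /S /= big_setU1.
pose c : R := t ^+ k.+2 / (k.+2`!%:R * N ^+ k.+2).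
have c0 : 0 <= c.
  by rewrite divr_ge0 ?exprn_ge0 // mulr_ge0 // exprn_ge0 // ltW.
have fact0 n : (n`!%:R : R) != 0 by rewrite pnatr_eq0 -lt0n fact_gt0.
(* [c * g j] is the integral of [(t - u) ^ k.+1 / k.+1!] for [u] over the first [j] slices, and
   [c * err j] is the gap between its upper and lower Riemann sums. *)
pose g (j : nat) : R := N ^+ k.+2 - (M.+1 - j)%:R ^+ k.+2.
pose err (j : nat) : R := k.+2%:R * (N ^+ k.+1 - (M.+1 - j)%:R ^+ k.+1).
have tN0 : 0 <= t / N by rewrite divr_ge0 // ltW.
have slice_prob a : (a <= M.+1)%N ->
    prob P [set x | S x < t * a%:R / N] = (t * a%:R / N) ^+ k.+1 / k.+1`!%:R.
  move=> aM; apply: HF; apply/andP; split.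
    by rewrite divr_ge0 ?mulr_ge0 // ltW.
  rewrite ler_pdivrMr // mul1r (le_trans (ler_wpM2l t0 (_ : _ <= N))) ?ler_nat //.
  by rewrite ler_piMl // ltW.
have main (j : nat) : (j <= M.+1)%N ->
    `|prob P (E `&` [set x | X i x < j%:R * (t / N)]) - c * g j| <= c * err j.
  elim: j => [_|j IH jM].
    rewrite /g /err subn0 !subrr !mulr0 subr0 mul0r.
    suff -> : prob P (E `&` [set x | X i x < 0]) = 0 by rewrite normr0.
    apply/eqP; rewrite eq_le prob_ge0 andbT -[leRHS](prob_uniform_lt0 unif iA).
    apply: le_prob; last by move=> x [].
      by apply: measurableI => //; exact: measurable_RV_lt.
    exact: measurable_RV_lt.
  have [b bE] : exists b, (M.+1 - j = b.+1)%N by exists (M - j)%N; rewrite subSn.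
  have bE' : (M.+1 - j.+1 = b)%N by rewrite subnS bE.
  pose J := [set x | j%:R * (t / N) <= X i x < j.+1%:R * (t / N)].
  have mJ : measurable J by exact: measurable_RV_itv.
  have ltjS : j%:R * (t / N) <= j.+1%:R * (t / N) by rewrite ler_wpM2r // ler_nat.
  have pJ : prob P J = t / N.
    have a0 : 0 <= j%:R * (t / N) by rewrite mulr_ge0.
    rewrite (prob_uniform_itv unif iA) //; first by rewrite -natr1; ring.
    rewrite mulrCA mulr_ile1 //; first by rewrite divr_ge0 // ltW.
    by rewrite ler_pdivrMr // mul1r ler_nat.
  have split_prob : prob P (E `&` [set x | X i x < j.+1%:R * (t / N)]) =
      prob P (E `&` [set x | X i x < j%:R * (t / N)]) + prob P (E `&` J).
    rewrite -prob_setU; last 3 first.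
    - by apply: measurableI => //; exact: measurable_RV_lt.
    - exact: measurableI.
    - apply/seteqP; split => // x [[_ /= h] [_ /andP[h' _]]].
      by move: h; rewrite ltNge h'.
    congr (prob P _); rewrite -setIUr; congr (_ `&` _); apply/seteqP; split => x /=.
      by rewrite /J /=; case: (ltP (X i x) (j%:R * (t / N))) => h; [left|right].
    by case=> [/lt_le_trans|/andP[]//]; exact.
  have indepJ s : prob P (J `&` [set x | S x < s]) = prob P J * prob P [set x | S x < s].
    apply: (prob_indep indep (A := [set i]%SET) (B := D)) => //.
    - by rewrite finset.sub1set.
    - by rewrite finset.disjoints1.
    - rewrite (_ : J = X i @^-1` `[j%:R * (t / N), j.+1%:R * (t / N)[%classic).
        by apply: sigma_cylinders_RV => //; rewrite finset.inE.
      by apply/seteqP; split => x /=; rewrite in_itv.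
    - exact: sigma_cylinders_sum_lt.
  have eN : t = M.+1%:R * (t / N) by rewrite mulrC divfK // gt_eqF.
  have jb : M.+1%:R = j%:R + b.+1%:R :> R by rewrite -natrD -bE subnKC // ltnW.
  have et : t = j%:R * (t / N) + b.+1%:R * (t / N) by rewrite -mulrDl -jb.
  have et' : t = j.+1%:R * (t / N) + b%:R * (t / N).
    by rewrite [LHS]et -!natr1 !mulrDl mul1r -!addrA [_ + b%:R * _]addrC.
  have slice a : (t / N) * ((t * a%:R / N) ^+ k.+1 / k.+1`!%:R) =
      c * (k.+2%:R * a%:R ^+ k.+1).
    rewrite /c (factS k.+1) natrM expr_div_n exprMn [t ^+ k.+2]exprS [N ^+ k.+2]exprS.
    by field; rewrite !fact0 expf_neq0 ?gt_eqF ?nat1r ?pnatr_eq0.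
  (* On the slice [J], the event [E] forces [S < b.+1 * (t / N)], from the left end of the slice;
     conversely [S < b * (t / N)] forces [E], from the right end. *)
  have up : prob P (E `&` J) <= c * (k.+2%:R * b.+1%:R ^+ k.+1).
    rewrite -slice -slice_prob; last by rewrite -bE leq_subr.
    rewrite -[X in _ <= X * _]pJ -indepJ.
    apply: le_prob; [exact: measurableI|apply: measurableI => //; exact: measurable_sum_lt|].
    move=> x [Ex Jx]; split => //; move: Ex Jx; rewrite /E /J /= => Ex /andP[h _].
    have -> : t * b.+1%:R / N = b.+1%:R * (t / N) by ring.
    by rewrite -(ltrD2l (X i x)) (lt_le_trans Ex) // [leLHS]et lerD2r.
  have low : c * (k.+2%:R * b%:R ^+ k.+1) <= prob P (E `&` J).
    rewrite -slice -slice_prob; last by rewrite -bE' leq_subr.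
    rewrite -[X in X * _ <= _]pJ -indepJ.
    apply: le_prob; [apply: measurableI => //; exact: measurable_sum_lt|exact: measurableI|].
    move=> x [Jx]; rewrite /S /= => Sx; split => //; move: Sx Jx.
    rewrite /E /J /S /= => Sx /andP[_ h].
    have eS : t * b%:R / N = b%:R * (t / N) by ring.
    by rewrite eS in Sx; rewrite [ltRHS]et' ltrD.
  have [g1 g2] := succX_sub_bounds R k.+1 b.
  have {}g1 := ler_wpM2l c0 g1; have {}g2 := ler_wpM2l c0 g2.
  have := IH (ltnW jM); rewrite split_prob /g /err bE bE' !ler_norml !mulrBr.
  rewrite !mulrBr in g1 g2 *.
  by move=> /andP[h1 h2]; apply/andP; split; lra.
have := main M.+1 (leqnn _); rewrite /g /err subnn !expr0n /= !subr0.
have -> : c * N ^+ k.+2 = t ^+ k.+2 / k.+2`!%:R.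
  by rewrite /c; field; rewrite fact0 expf_neq0 ?gt_eqF.
(* Almost surely [S] is non-negative (the case [s = 0] of the induction hypothesis), and then [E]
   forces [X i < t]: the slices cover [E] up to a null event. *)
have pE : prob P E = prob P (E `&` [set x | X i x < M.+1%:R * (t / N)]).
  have eN : t = M.+1%:R * (t / N) by rewrite mulrC divfK // gt_eqF.
  rewrite -eN.
  have mS0 : measurable [set x | S x < 0] by exact: measurable_sum_lt.
  have mX : measurable [set x | X i x < t] by exact: measurable_RV_lt.
  have S0 : prob P [set x | S x < 0] = 0.
    by have := slice_prob 0%N isT; rewrite mulr0 mul0r expr0n /= mul0r.
  apply/eqP; rewrite eq_le; apply/andP; split; last first.
    by apply: le_prob; [exact: measurableI|exact: mE|move=> x []].
  have mEX : measurable (E `&` [set x | X i x < t]) by exact: measurableI.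
  rewrite -(prob_setU0 mEX mS0 S0); apply: le_prob => //; first exact: measurableU.
  move=> x; rewrite /E /= => Ex; case: (ltP (S x) 0) => h; first by right.
  by left; split => //; apply: le_lt_trans Ex; rewrite lerDl.
rewrite -pE => /le_trans; apply.
rewrite -/N /c [N ^+ k.+2]exprS (factS k.+1) natrM.
have -> : t ^+ k.+2 / (k.+2%:R * (k.+1)`!%:R * (N * N ^+ k.+1)) * (k.+2%:R * N ^+ k.+1) =
  t ^+ k.+2 / (k.+1)`!%:R / N.
  by field; rewrite !fact0 expf_neq0 ?gt_eqF ?nat1r ?pnatr_eq0.
apply: ler_piMl; first by rewrite invr_ge0 ltW.
rewrite ler_pdivrMr ?ltr0n ?fact_gt0 // mul1r.
apply: (@le_trans _ _ 1); first exact: exprn_ile1.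
by rewrite ler1n fact_gt0.
Qed.

(** For [t <= 1] this is the volume of a corner simplex contained in the unit cube. Induction on the
    size of [D]; the slicing error [1 / M.+1] is arbitrarily small. *)
Lemma prob_sum_lt (D : {set I}) (t : R) : D \subset A0 -> (0 < #|D|)%N ->
  0 <= t <= 1 ->
  prob P [set x | \sum_(i in D) X i x < t] = t ^+ #|D| / (#|D|)`!%:R.
Proof.
case e : #|D| => [//|k] sD _; elim: k D e sD t => [|k IH] D e sD t t01.
  have /eqP/cards1P[i Di] := e; rewrite Di in sD *.
  under eq_set do rewrite big_set1.
  by rewrite (prob_uniform_lt unif) ?expr1 ?fact1 ?divr1 // -finset.sub1set.
have /card_gt0P[i iD] : (0 < #|D|)%N by rewrite e.
have iD' : i \notin (D :\ i)%SET by rewrite !finset.inE eqxx.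
have eD' : #|(D :\ i)%SET| = k.+1 by move: e; rewrite (cardsD1 i) iD add1n => -[].
have sD' : (D :\ i)%SET \subset A0 by apply: fintype.subset_trans sD; exact: subsetDl.
have iA : i \in A0 by exact: (fintype.subsetP sD).
apply/eqP; rewrite -subr_eq0 -normr_le0; apply/ler_addgt0Pl => eps eps0; rewrite addr0.
have [M hM] : exists M, M.+1%:R^-1 <= eps.
  exists (Num.truncn eps^-1); rewrite -[leRHS]invrK lef_pV2 ?posrE ?invr_gt0 //.
  by rewrite ltW // truncnS_gt.
apply: le_trans hM; rewrite -{1}(finset.setD1K iD).
by apply: prob_sum_lt_step => // s s01; exact: IH.
Qed.

End irwin_hall.

(** * Poisson approximation *)

Section stein_chen.
Context (R : realType) (J : finType) (Q : {set J} -> R) (N : J -> {set J}).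
Hypothesis Q_ge0 : forall S, 0 <= Q S.
Hypothesis Q_sum1 : \sum_(S : {set J}) Q S = 1.
Hypothesis N_refl : forall a, a \in N a.

Let p (a : J) : R := \sum_(S : {set J} | a \in S) Q S.
Let p2 (a b : J) : R := \sum_(S : {set J} | (a \in S) && (b \in S)) Q S.

Hypothesis Q_indep : forall a S',
  \sum_(S : {set J} | (a \in S) && ((S :\: N a)%SET == S')) Q S =
  p a * \sum_(S : {set J} | (S :\: N a)%SET == S') Q S.

Let p_ge0 a : 0 <= p a.
Proof. exact: sumr_ge0. Qed.

(** [Q S] stands for the probability that [S] is exactly the set of events that occur. Summing over
    the values of [S :\: N a], of which the event [a] is independent, gives the product. *)
Lemma indep_expectation a (h : {set J} -> R) :
  \sum_(S : {set J} | a \in S) Q S * h (S :\: N a)%SET =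
  p a * \sum_(S : {set J}) Q S * h (S :\: N a)%SET.
Proof.
rewrite (partition_big (fun S => S :\: N a)%SET xpredT) //=.
rewrite [in RHS](partition_big (fun S => S :\: N a)%SET xpredT) //= mulr_sumr.
apply: eq_bigr => S' _.
under eq_bigr => S /andP[_ /eqP ->] do [].
under [in RHS]eq_bigr => S /eqP -> do [].
by rewrite -!mulr_suml Q_indep mulrA.
Qed.

Lemma dist_exprn_le (c : R) (k l : nat) : 0 <= c <= 1 -> (k <= l)%N ->
  `|c ^+ k - c ^+ l| <= (l - k)%:R.
Proof.
move=> /andP[c0 c1] kl; have [->|lt_kl] := eqVneq k l.
  by rewrite subrr normr0 subnn.
have ckl : c ^+ l <= c ^+ k by exact: ler_wiXn2l.
rewrite ger0_norm ?subr_ge0 // (@le_trans _ _ 1) //.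
  rewrite lerBlDr (le_trans (exprn_ile1 k c0 c1)) // lerDl exprn_ge0 //.
by rewrite ler1n subn_gt0 ltn_neqAle lt_kl.
Qed.

(* [E[u^Z] exp(- lambda u)] interpolates between [P(Z = 0)] at [u = 0] and
   [exp(- lambda)] at [u = 1]. *)
Lemma stein_chen : `|Q finset.set0 - expR (- \sum_a p a)| <=
  \sum_a \sum_(b in N a) p a * p b + \sum_a \sum_(b in N a | b != a) p2 a b.
Proof.
set lam := \sum_a p a.
pose q : {poly R} := \sum_(S : {set J}) Q S *: 'X^#|S|.
have qE u : q.[u] = \sum_(S : {set J}) Q S * u ^+ #|S|.
  by rewrite horner_sum; apply: eq_bigr => S _; rewrite hornerZ hornerXn.
(* [q] is the probability generating function of the number of events. In its derivative, the factor
   [#|S|] is spread over the elements [a] of [S]. *)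
have dqE u : q^`().[u] = \sum_a \sum_(S : {set J} | a \in S) Q S * u ^+ #|(S :\ a)%SET|.
  rewrite raddf_sum /= horner_sum [RHS](exchange_big_dep xpredT) //=.
  apply: eq_bigr => S _; rewrite derivZ derivXn hornerZ hornerMn hornerXn.
  rewrite -mulr_sumr; congr (_ * _).
  rewrite (eq_bigr (fun=> u ^+ #|S|.-1)) => [|a aS].
    by rewrite sumr_const.
  by rewrite (cardsD1 a S) aS.
pose g u := q.[u] * expR (- lam * u).
pose dg u := q.[u] * (expR (- lam * u) * - lam) + expR (- lam * u) * q^`().[u].
have dgP (u : R) : is_derive u 1 g (dg u).
  have d1 : is_derive u 1 (fun x => - lam * x) (- lam).
    by apply: is_derive_eq; rewrite /GRing.scale /= mulr1.
  have d2 : is_derive u 1 (fun x => expR (- lam * x)) (expR (- lam * u) * - lam).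
    by have := @is_derive1_comp R expR (fun x => - lam * x) u _ _ _ d1; apply.
  have d3 : is_derive u 1 (horner q) (q^`().[u]) by exact: is_derive_poly.
  exact: is_deriveM.
have [c c01] : exists2 c, c \in `]0, 1[ & g 1 - g 0 = dg c * (1 - 0).
  apply: MVT => //; apply: derivable_within_continuous => x _.
  exact: ex_derive.
rewrite subr0 mulr1 in_itv /= in c01 * => dgc.
have {c01} c01 : 0 <= c <= 1 by case/andP: c01 => /ltW -> /ltW ->.
have g0 : g 0 = Q finset.set0.
  rewrite /g mulr0 expR0 mulr1 qE (bigD1 finset.set0) //= cards0 expr0 mulr1.
  rewrite big1 ?addr0 // => S S0; rewrite expr0n cards_eq0 (negPf S0) mulr0 //.
have g1 : g 1 = expR (- lam).
  by rewrite /g mulr1 qE; under eq_bigr do rewrite expr1n mulr1; rewrite Q_sum1 mul1r.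
rewrite -g0 -g1 distrC dgc.
have -> : dg c = expR (- lam * c) *
    \sum_a (\sum_(S : {set J} | a \in S) Q S * c ^+ #|(S :\ a)%SET| - p a * q.[c]).
  by rewrite sumrB -mulr_suml -/lam -dqE /dg; ring.
rewrite normrM.
have lam0 : 0 <= lam by exact: sumr_ge0.
have e1 : `|expR (- lam * c)| <= 1.
  rewrite ger0_norm ?expR_ge0 // -expR0 ler_expR mulNr oppr_le0 mulr_ge0 //.
  by case/andP: c01.
rewrite (le_trans (ler_wpM2r (normr_ge0 _) e1)) // mul1r.
rewrite -big_split /= (le_trans (ler_norm_sum _ _ _)) //; apply: ler_sum => a _.
(* The exponent passes from [S :\ a] to [S :\: N a], where the event [a] decouples, and then to [S].
   The first change costs the joint probabilities of [a] with its neighbours, the second costs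
   products of probabilities. *)
have -> : \sum_(S : {set J} | a \in S) Q S * c ^+ #|(S :\ a)%SET| - p a * q.[c] =
    \sum_(S : {set J} | a \in S) Q S * (c ^+ #|(S :\ a)%SET| - c ^+ #|(S :\: N a)%SET|) +
    p a * \sum_(S : {set J}) Q S * (c ^+ #|(S :\: N a)%SET| - c ^+ #|S|).
  rewrite qE.
  under [X in _ = X + _]eq_bigr do rewrite mulrBr.
  under [X in _ = _ + _ * X]eq_bigr do rewrite mulrBr.
  rewrite !sumrB mulrBr (indep_expectation a (fun S => c ^+ #|S|)).
  by rewrite addrA subrK.
rewrite [X in `|X|]addrC (le_trans (ler_normD _ _)) //.
apply: lerD.
  rewrite normrM (ger0_norm (p_ge0 a)) -mulr_sumr ler_wpM2l //.
  rewrite (le_trans (ler_norm_sum _ _ _)) //.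
  rewrite /p [leRHS](exchange_big_dep xpredT) //=.
  apply: ler_sum => S _; rewrite normrM (ger0_norm (Q_ge0 S)) sumr_const -mulr_natr.
  rewrite ler_wpM2l // (le_trans (dist_exprn_le c01 _)) ?subset_leq_card ?finset.subsetDl //.
  rewrite ler_nat -(cardsID (N a) S) addnK; apply: subset_leq_card.
  by apply/fintype.subsetP => b; rewrite !inE andbC.
rewrite (le_trans (ler_norm_sum _ _ _)) //.
rewrite /p2 [leRHS](exchange_big_dep (fun S : {set J} => a \in S)) /=; last first.
  by move=> b S _ /andP[].
apply: ler_sum => S aS; rewrite normrM (ger0_norm (Q_ge0 S)) sumr_const -mulr_natr.
rewrite ler_wpM2l //.
have sub : (S :\: N a \subset S :\ a)%SET.
  by apply: finset.setDS; rewrite finset.sub1set.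
rewrite distrC (le_trans (dist_exprn_le c01 (subset_leq_card sub))) //.
rewrite -(finset.setIidPr sub) ler_nat -cardsD; apply: subset_leq_card.
apply/fintype.subsetP => b; rewrite !inE => /andP[+ /andP[ba bS]].
rewrite bS andbT negbK => bN.
by apply/andP; split; [rewrite bN ba|rewrite aS bS].
Qed.

End stein_chen.

Section poisson_approximation.
Context (R : realType) (d : measure_display) (Omega : measurableType d).
Variable P : probability Omega R.

Section events.
Context (J : finType) (A : J -> set Omega) (N : J -> {set J}).

Definition occurring (x : Omega) : {set J} := [set a | `[< A a x >]]%SET.

Lemma occurringP a x : (a \in occurring x) <-> A a x.
Proof. by rewrite inE; split => /asboolP. Qed.

(** The event is expressed through the [A a] with [a] outside [D] only, which later places it in the
    sigma-algebra of the variables that these events involve. *)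
Lemma occurring_setDE (D S : {set J}) : S \subset ~: D ->
  [set x | (occurring x :\: D)%SET = S] =
  \bigcap_(a in [set` (~: D)%SET]) (if a \in S then A a else ~` A a).
Proof.
move=> sSD; apply/seteqP; split => x /=.
  move=> <- a /=; rewrite finset.in_setC => aD; rewrite finset.in_setD aD /=.
  by case: ifPn => [/occurringP//|/negP h /occurringP].
move=> h; apply/setP => a; rewrite finset.in_setD.
have [aD|aD] /= := boolP (a \in D).
  apply/esym/negbTE; apply: contraL aD => /(fintype.subsetP sSD).
  by rewrite finset.in_setC.
have := h a; rewrite /= finset.in_setC => /(_ aD); case: ifP => _.
  by move/occurringP.
by move=> na; apply/negbTE/negP => /occurringP.
Qed.

Lemma occurring_setDE0 (D S : {set J}) : ~~ (S \subset ~: D) ->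
  [set x | (occurring x :\: D)%SET = S] = set0.
Proof.
move=> sSD; apply/seteqP; split => // x /= e; move: sSD; rewrite -e.
by rewrite finset.setDE finset.subsetIr.
Qed.

Hypothesis mA : forall a, measurable (A a).

Lemma measurable_occurring_setD D S :
  measurable [set x | (occurring x :\: D)%SET = S].
Proof.
have [sSD|sSD] := boolP (S \subset ~: D)%SET; last by rewrite occurring_setDE0.
rewrite occurring_setDE //; apply: fin_bigcap_measurable => // a _.
by case: ifP => _ //; exact: measurableC.
Qed.

Lemma measurable_occurring S : measurable [set x | occurring x = S].
Proof.
have := measurable_occurring_setD finset.set0 S.
by congr (measurable _); apply/seteqP; split => x /=; rewrite finset.setD0.
Qed.

Lemma sum_prob_occurring (B : set Omega) (pr : pred {set J}) : measurable B ->
  \sum_(S | pr S) prob P (B `&` [set x | occurring x = S]) =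
  prob P (B `&` [set x | pr (occurring x)]).
Proof.
move=> mB; rewrite -big_filter -prob_fibers //; last 2 first.
- by rewrite filter_uniq // index_enum_uniq.
- exact: measurable_occurring.
congr (prob P (_ `&` _)); apply/seteqP; split => x /=;
  by rewrite mem_filter mem_index_enum andbT.
Qed.

Hypothesis N_refl : forall a, a \in N a.
Hypothesis A_indep : forall a S,
  prob P (A a `&` [set x | (occurring x :\: N a)%SET = S]) =
  prob P (A a) * prob P [set x | (occurring x :\: N a)%SET = S].

Lemma poisson_events :
  `|prob P [set x | forall a, ~ A a x] - expR (- \sum_a prob P (A a))| <=
  \sum_a \sum_(b in N a) prob P (A a) * prob P (A b) +
  \sum_a \sum_(b in N a | b != a) prob P (A a `&` A b).
Proof.
pose Q S := prob P [set x | occurring x = S].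
have QE (pr : pred {set J}) : \sum_(S | pr S) Q S = prob P [set x | pr (occurring x)].
  rewrite -[in RHS](setTI [set x | _]) -sum_prob_occurring //.
  by apply: eq_bigr => S _; rewrite setTI.
have pE a : \sum_(S : {set J} | a \in S) Q S = prob P (A a).
  by rewrite QE; congr (prob P _); apply/seteqP; split => x /occurringP.
have p2E a b : \sum_(S : {set J} | (a \in S) && (b \in S)) Q S = prob P (A a `&` A b).
  rewrite QE; congr (prob P _); apply/seteqP; split => x /=.
    by case/andP => /occurringP ? /occurringP.
  by case=> /occurringP -> /occurringP.
have Q1 : \sum_S Q S = 1.
  by rewrite QE -[RHS](prob_setT P); congr (prob P _); apply/seteqP.
have indepQ a S' : \sum_(S : {set J} | (a \in S) && ((S :\: N a)%SET == S')) Q S =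
    (\sum_(S : {set J} | a \in S) Q S) * \sum_(S | (S :\: N a)%SET == S') Q S.
  rewrite pE !QE (_ : [set x | (occurring x :\: N a)%SET == S'] =
     [set x | (occurring x :\: N a)%SET = S']); last first.
    by apply/seteqP; split => x /eqP.
  rewrite -A_indep; congr (prob P _); apply/seteqP; split => x /=.
    by case/andP => /occurringP ? /eqP.
  by case=> /occurringP -> /eqP.
have := @stein_chen R J Q N (fun S => prob_ge0 _ _) Q1 N_refl indepQ.
have -> : Q finset.set0 = prob P [set x | forall a, ~ A a x].
  congr (prob P _); apply/seteqP; split => x /=.
    by move=> e a /occurringP; rewrite e finset.inE.
  by move=> h; apply/setP => a; rewrite finset.in_set0; apply/negbTE/negP => /occurringP /h.
under eq_bigr do rewrite pE.
under [X in _ <= X + _]eq_bigr do under eq_bigr do rewrite !pE.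
by under [X in _ <= _ + X]eq_bigr do under eq_bigr do rewrite p2E.
Qed.

End events.

Section sums.
Context (I : finType) (X : I -> {RV P >-> R}) (A0 : {set I}).
Hypothesis indep : mutually_independent A0 X.
Hypothesis unif : forall i, i \in A0 -> uniform01 (X i).

Lemma prob_all_lt (U : {set I}) (t : R) : U \subset A0 -> 0 <= t <= 1 ->
  prob P (\bigcap_(i in [set` U]) [set x | X i x < t]) = t ^+ #|U|.
Proof.
move=> sU t01.
have e i : [set x | X i x < t] = X i @^-1` `]-oo, t[%classic.
  by apply/seteqP; split => x /=; rewrite in_itv.
apply: EFin_inj; rewrite -probE; last first.
  by apply: fin_bigcap_measurable => // i _; exact: measurable_RV_lt.
under eq_bigcapr do rewrite e.
rewrite (indep (S := fun=> `]-oo, t[%classic)) //.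
rewrite (eq_bigr (fun=> t%:E)) => [|i iU].
  by rewrite prodEFin prodr_const.
rewrite -e probE; last exact: measurable_RV_lt.
by rewrite (prob_uniform_lt unif) // (fintype.subsetP sU).
Qed.

(** Off the null event [neg] that some variable is negative, each term is at most its sum, so both
    sums being below [t] forces every variable of the union below [t]. *)
Lemma prob_sum_lt2 (D D' : {set I}) (t : R) : D \subset A0 -> D' \subset A0 ->
  0 <= t <= 1 ->
  prob P ([set x | \sum_(i in D) X i x < t] `&` [set x | \sum_(i in D') X i x < t]) <=
  t ^+ #|D :|: D'|.
Proof.
move=> sD sD' t01.
pose neg := \big[setU/set0]_(i <- enum A0) [set x | X i x < 0].
have mneg : measurable neg.
  by apply: bigsetU_measurable => i _; exact: measurable_RV_lt.
have neg0 : prob P neg = 0.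
  apply: prob_bigsetU0 => [i|i]; first exact: measurable_RV_lt.
  by rewrite mem_enum; exact: (prob_uniform_lt0 unif).
have sU : D :|: D' \subset A0 by rewrite finset.subUset sD.
have mAll : measurable (\bigcap_(i in [set` D :|: D']) [set x | X i x < t]).
  by apply: fin_bigcap_measurable => // i _; exact: measurable_RV_lt.
rewrite -(prob_all_lt sU t01) -(prob_setU0 mAll mneg neg0).
apply: le_prob.
- by apply: measurableI; exact: measurable_sum_lt.
- exact: measurableU.
move=> x [/= hD hD']; have [h|h] := pselect (neg x); [by right|left].
have X0 i : i \in A0 -> 0 <= X i x.
  move=> iA; rewrite leNgt; apply/negP => Xi; apply: h.
  by rewrite /neg -bigcup_seq; exists i => //=; rewrite mem_enum.
have small (B : {set I}) i : B \subset A0 -> \sum_(i in B) X i x < t -> i \in B -> X i x < t.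
  move=> /fintype.subsetP sB hB iB; apply: le_lt_trans hB.
  rewrite (bigD1 i) //= lerDl; apply: sumr_ge0 => j /andP[jB _].
  exact/X0/sB.
move=> i /=; rewrite finset.in_setU => /orP[] iD; first exact: small hD iD.
exact: small hD' iD.
Qed.

(** Events whose index sets are disjoint from [E a] depend on other variables, so the neighbourhood
    of [a] consists of [a] and the [b] whose index sets meet [E a]. Indices outside [F] receive the
    empty event. *)
Lemma poisson_sums (J : finType) (E : J -> {set I}) (F : {set J}) (m : nat) (t : R) :
  (forall a, a \in F -> E a \subset A0) -> (forall a, a \in F -> #|E a| = m) ->
  (0 < m)%N -> 0 <= t <= 1 ->
  `|prob P [set x | forall a, a \in F -> t <= \sum_(i in E a) X i x] -
    expR (- (#|F|%:R * (t ^+ m / m`!%:R)))| <=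
  #|F|%:R * t ^+ (2 * m) +
  2 * \sum_(a in F) \sum_(b in F | (b != a) && ~~ [disjoint E a & E b]%bool)
        t ^+ #|E a :|: E b|.
Proof.
move=> sE cE m0 t01; have [t0 t1] := andP t01.
pose A a := if a \in F then [set x | \sum_(i in E a) X i x < t] else set0.
pose N a := [set b | (b == a) || ~~ [disjoint E a & E b]%bool]%SET.
have mA a : measurable (A a).
  by rewrite /A; case: ifP => // _; exact: measurable_sum_lt.
have N_refl a : a \in N a by rewrite inE eqxx.
have pA a : prob P (A a) = if a \in F then t ^+ m / m`!%:R else 0.
  rewrite /A; case: ifP => aF; last exact: prob_set0.
  by rewrite (prob_sum_lt indep unif) ?cE // sE.
have indepA a S : prob P (A a `&` [set x | (occurring A x :\: N a)%SET = S]) =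
    prob P (A a) * prob P [set x | (occurring A x :\: N a)%SET = S].
  rewrite /A; case: ifP => aF; last by rewrite set0I prob_set0 mul0r.
  apply: (prob_indep indep (A := E a) (B := (A0 :\: E a)%SET)).
  - exact: sE.
  - exact: finset.subsetDl.
  - by rewrite disjoint_subset; apply/fintype.subsetP => i iE; rewrite !inE iE.
  - exact: sigma_cylinders_sum_lt.
  have [sS|sS] := boolP (S \subset ~: N a)%SET; last first.
    by rewrite occurring_setDE0 //; exact: (@measurable0 _ (g_sigma_algebraType _)).
  rewrite occurring_setDE //.
  apply: (@fin_bigcap_measurable _ (g_sigma_algebraType (cylinders X (A0 :\: E a)%SET))) => //.
  move=> b /=; rewrite finset.in_setC inE negb_or negbK => /andP[_ dab].
  have mAb : <<s cylinders X (A0 :\: E a)%SET >> (A b).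
    rewrite /A; case: ifP => bF; last exact: (@measurable0 _ (g_sigma_algebraType _)).
    apply: sigma_cylinders_sum_lt; rewrite finset.subsetD sE //=.
    by rewrite disjoint_sym.
  case: ifP => _ //; exact: (@measurableC _ (g_sigma_algebraType _)).
have := poisson_events mA N_refl indepA.
have -> : [set x | forall a, ~ A a x] =
    [set x | forall a, a \in F -> t <= \sum_(i in E a) X i x].
  apply/seteqP; split => x /= h a.
    by move=> aF; rewrite leNgt; apply/negP => lt_t; apply: (h a); rewrite /A aF.
  rewrite /A; case: ifP => [aF /= lt_t|_ []].
  by have := h a aF; rewrite leNgt lt_t.
have -> : \sum_a prob P (A a) = #|F|%:R * (t ^+ m / m`!%:R).
  under eq_bigr do rewrite pA.
  by rewrite -big_mkcond sumr_const mulr_natl.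
move=> /le_trans; apply.
have p_le : t ^+ m / m`!%:R <= t ^+ m.
  rewrite ler_pdivrMr ?ltr0n ?fact_gt0 // ler_peMr ?exprn_ge0 //.
  by rewrite ler1n fact_gt0.
have p_ge0 : 0 <= t ^+ m / m`!%:R by rewrite divr_ge0 ?exprn_ge0.
have pp a b : prob P (A a) * prob P (A b) <=
    if (a \in F) && (b \in F) then t ^+ (2 * m) else 0.
  rewrite !pA; case: (a \in F); case: (b \in F); rewrite ?mul0r ?mulr0 //=.
  by rewrite mul2n -addnn exprD ler_pM.
have le2m a b : a \in F -> b \in F -> t ^+ (2 * m) <= t ^+ #|E a :|: E b|.
  move=> aF bF; apply: ler_wiXn2l => //.
  by rewrite (leq_trans (leq_card_setU _ _)) // !cE // mul2n addnn.
(* [T] is paid twice: for joint probabilities, and for products, since [t ^ (2 * m)] is at most [t]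
   to the size of the union. The diagonal products give the remaining term. *)
set T := \sum_(a in F) _.
have b1 : \sum_a \sum_(b in N a) prob P (A a) * prob P (A b) <=
    #|F|%:R * t ^+ (2 * m) + T.
  rewrite mulr_natl -sumr_const /T -big_split /= [leRHS]big_mkcond /=.
  apply: ler_sum => a _; case: ifP => aF; last first.
    apply: sumr_le0 => b _.
    by have := pp a b; rewrite aF.
  rewrite (bigD1 a) //= lerD //.
    by have := pp a a; rewrite aF.
  rewrite big_mkcond [leRHS]big_mkcond /=; apply: ler_sum => b _.
  rewrite !inE; have [->|ba] /= := eqVneq b a; first by rewrite andbF.
  rewrite andbT; case: (boolP [disjoint E a & E b]%bool) => dab /=.
    by rewrite andbF.
  rewrite andbT; have := pp a b; rewrite aF /=.
  by case: ifP => // bF /le_trans; apply; exact: le2m.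
have b2 : \sum_a \sum_(b in N a | b != a) prob P (A a `&` A b) <= T.
  rewrite /T [leRHS]big_mkcond /=; apply: ler_sum => a _; case: ifP => aF; last first.
    by apply: sumr_le0 => b _; rewrite /A aF set0I prob_set0.
  rewrite big_mkcond [leRHS]big_mkcond /=; apply: ler_sum => b _.
  rewrite !inE; have [->|ba] /= := eqVneq b a; first by rewrite andbF.
  rewrite andbT; case: (boolP [disjoint E a & E b]%bool) => dab /=.
    by rewrite andbF.
  rewrite andbT {1}/A aF /A; case: ifP => bF; last by rewrite setI0 prob_set0.
  by apply: prob_sum_lt2 => //; exact: sE.
by move: b1 b2; lra.
Qed.

End sums.
End poisson_approximation.

(** * The event that no copy inside a vertex set is light *)

Section escape.
Context (R : realType) (d : measure_display) (Omega : measurableType d).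
Context (P : probability Omega R) (T U : finType) (H : graph T).
Variable w : {set U} -> {RV P >-> R}.
Let pairs : {set {set U}} := [set e : {set U} | #|e| == 2]%SET.
Hypothesis indep : mutually_independent pairs w.
Hypothesis unif : forall e, e \in pairs -> uniform01 (w e).
Hypothesis balH : strictly_balanced H.
Hypothesis edgeH : (0 < #|edges H|)%N.
Let m := #|edges H|.
Let v := #|vertices H|.
Let a := #|automorphisms H|.

(** For [B] the full vertex set of a large enough complete graph this is the event [t <= W]; smaller
    [B] serve as blocks. *)
Definition escape (B : {set U}) (t : R) : set Omega :=
  [set x | forall G, G \in copies H B -> t <= weight (fun e => w e x) G].

Lemma vertices_gt0 : (0 < v)%N.
Proof.
have /card_gt0P[e eH] := edgeH.
rewrite (leq_trans _ (subset_leq_card (edges_sub_vertices eH))) //.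
by rewrite (card_edge eH).
Qed.

Lemma automorphisms_gt0 : (0 < a)%N.
Proof.
apply/card_gt0P; exists 1%g; rewrite inE perm_on1 /=.
rewrite (eq_in_imset (g := id)) ?imset_id // => e _.
rewrite (eq_in_imset (g := id)) ?imset_id // => x _.
by rewrite perm1.
Qed.

Lemma edges_sub_pairs (G : graph U) : edges G \subset pairs.
Proof. by apply/fintype.subsetP => e eG; rewrite inE (card_edge eG). Qed.

Let pairs_on (B : {set U}) : {set {set U}} := [set e in pairs | e \subset B]%SET.

Lemma edges_sub_pairs_on (B : {set U}) G : G \in copies H B ->
  edges G \subset pairs_on B.
Proof.
move=> /copiesP[_ sG]; apply/fintype.subsetP => e eG.
rewrite !inE (card_edge eG) eqxx /=.
by apply: fintype.subset_trans sG; exact: edges_sub_vertices.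
Qed.

Lemma escapeE (B : {set U}) t : escape B t =
  \bigcap_(G in [set` copies H B]) ~` [set x | \sum_(e in edges G) w e x < t].
Proof.
apply/seteqP; split => x /= h G GC; have := h G GC; rewrite /weight leNgt.
  by move=> /negP.
by move=> /= /negP.
Qed.

Lemma sigma_escape (B : {set U}) t : <<s cylinders w (pairs_on B) >> (escape B t).
Proof.
rewrite escapeE.
apply: (@fin_bigcap_measurable _ (g_sigma_algebraType (cylinders w (pairs_on B)))) => //.
move=> G GC; apply: (@measurableC _ (g_sigma_algebraType _)).
by apply: sigma_cylinders_sum_lt; exact: edges_sub_pairs_on.
Qed.

Lemma measurable_escape (B : {set U}) t : measurable (escape B t).
Proof.
apply: (@sigma_cylinders_measurable _ _ _ P _ w (pairs_on B)).
exact: sigma_escape.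
Qed.

Lemma escape_anti (B : {set U}) s t : s <= t -> escape B t `<=` escape B s.
Proof. by move=> st x /= h G /h; exact: le_trans. Qed.

Lemma escape_sub (B B' : {set U}) t : B \subset B' -> escape B' t `<=` escape B t.
Proof.
move=> sB x /= h G GC; apply: h; exact: (fintype.subsetP (copiesS H sB)).
Qed.

(** Copies inside [B] and copies inside [B'] use disjoint sets of pairs, hence independent weights.
    Copies meeting both blocks are dropped, whence an inequality. *)
Lemma prob_escape_disjoint (B B' : {set U}) t : [disjoint B & B']%bool ->
  prob P (escape (B :|: B') t) <= prob P (escape B t) * prob P (escape B' t).
Proof.
move=> dB; rewrite -(prob_indep indep (A := pairs_on B) (B := pairs_on B')).
- apply: le_prob.
  + exact: measurable_escape.
  + by apply: measurableI; exact: measurable_escape.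
  + move=> x h; split; apply: escape_sub h; first exact: finset.subsetUl.
    exact: finset.subsetUr.
- by apply/fintype.subsetP => e; rewrite inE => /andP[].
- by apply/fintype.subsetP => e; rewrite inE => /andP[].
- rewrite disjoint_subset; apply/fintype.subsetP => e; rewrite !inE.
  move=> /andP[/eqP e2 /fintype.subsetP eB]; rewrite e2 eqxx /=.
  have /card_gt0P[x xe] : (0 < #|e|)%N by rewrite e2.
  apply/negP => /fintype.subsetP/(_ x xe); rewrite (disjointFr dB) //; exact: eB.
- exact: sigma_escape.
- exact: sigma_escape.
Qed.

Lemma exists_subset_card (B : {set U}) k : (k <= #|B|)%N ->
  exists2 B' : {set U}, B' \subset B & #|B'| = k.
Proof.
move=> kB; have : (0 < #|[set A : {set U} | A \subset B & #|A| == k]|)%N.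
  by rewrite cards_draws bin_gt0.
by case/card_gt0P => B'; rewrite inE => /andP[sB /eqP]; exists B'.
Qed.

Lemma prob_escape_blocks (k r : nat) t (b : R) : 0 <= b ->
  (forall B : {set U}, #|B| = k -> prob P (escape B t) <= b) ->
  forall B : {set U}, (r * k <= #|B|)%N -> prob P (escape B t) <= b ^+ r.
Proof.
move=> b0 hb; elim: r => [|r IH] B.
  by move=> _; rewrite expr0 prob_le1 //; exact: measurable_escape.
rewrite mulSn => kB.
have [B' sB' cB'] := exists_subset_card (leq_trans (leq_addr _ _) kB).
have cB : (r * k <= #|(B :\: B')%SET|)%N.
  by rewrite cardsD (finset.setIidPr sB') cB' leq_subRL // (leq_trans (leq_addr _ _) kB).
have dB : [disjoint B' & B :\: B']%bool.
  by rewrite disjoint_subset; apply/fintype.subsetP => e eB; rewrite !inE eB.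
have -> : B = B' :|: (B :\: B')%SET.
  by rewrite -[LHS](setID B B') (finset.setIidPr sB').
rewrite (le_trans (prob_escape_disjoint t dB)) // exprS ler_pM ?prob_ge0 //.
  exact: hb.
exact: IH.
Qed.

Lemma copies_edges_pairs (B : {set U}) G : G \in copies H B -> edges G \subset pairs.
Proof. by move=> _; exact: edges_sub_pairs. Qed.

Lemma copies_card_edges (B : {set U}) G : G \in copies H B -> #|edges G| = m.
Proof. by case/copiesP => /card_isomorphic_edges. Qed.

Lemma card_copies_bound (B : {set U}) : (#|copies H B| <= #|B| ^ v)%N.
Proof.
have [->|[u0 _]] := set_0Vmem B.
  rewrite (_ : copies H finset.set0 = finset.set0) ?cards0 //.
  apply/setP => G; rewrite [RHS]inE; apply/negbTE/negP => /copiesP[iG].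
  rewrite finset.subset0 => /eqP e; have := vertices_gt0.
  by rewrite /v -(card_isomorphic_vertices iG) e cards0.
apply: leq_trans (ffact_le_exp _ _); rewrite -(card_copies H B u0).
by rewrite leq_pmulr // automorphisms_gt0.
Qed.

(** The 1 pays for the diagonal products, the rest for twice the sum over overlapping pairs. *)
Definition poisson_error : nat :=
  (1 + 2 * (pair_count (2 * v) * (2 * v).+1))%N.

(** In the diagonal term [#|copies H B| * (z * y ^ v) ^ (2 * m)], one factor [y ^ (v * m)] cancels
    the number of copies, at most [#|B| ^ v], and the other is at most [y]. *)
Lemma poisson_escape (B : {set U}) (z y K : R) :
  0 <= z <= K -> 1 <= K -> 0 <= y <= 1 -> #|B|%:R * y ^+ m = 1 -> z * y ^+ v <= 1 ->
  `|prob P (escape B (z * y ^+ v)) -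
    expR (- (#|copies H B|%:R * ((z * y ^+ v) ^+ m / m`!%:R)))| <=
  poisson_error%:R * K ^+ (2 * m) * y.
Proof.
move=> zK K1 y01 yB t1; have /andP[z0 zK'] := zK; have /andP[y0 y1] := y01.
have t01 : 0 <= z * y ^+ v <= 1 by rewrite mulr_ge0 ?exprn_ge0.
have := poisson_sums indep unif (E := fun G : graph U => edges G) (F := copies H B)
  (@copies_edges_pairs B) (@copies_card_edges B) edgeH t01.
move=> /le_trans; apply.
have -> : poisson_error%:R * K ^+ (2 * m) * y = K ^+ (2 * m) * y +
    2 * ((pair_count (2 * v) * (2 * v).+1)%:R * K ^+ (2 * m) * y).
  rewrite /poisson_error natrD natrM; move: ((pair_count _ * _)%:R) (K ^+ _) => p q.
  by ring.
apply: lerD; last first.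
  by apply: ler_wpM2l => //; apply: copies_pair_sum => //; rewrite yB.
have cb : #|copies H B|%:R * y ^+ (v * m) <= 1.
  rewrite mulnC exprM; apply: (@le_trans _ _ ((#|B| ^ v)%:R * (y ^+ m) ^+ v)).
    by rewrite ler_wpM2r ?exprn_ge0 // ler_nat card_copies_bound.
  by rewrite natrX -exprMn yB expr1n.
rewrite exprMn -exprM [(v * _)%N]mulnCA [(2 * _)%N in X in _ * (_ * X)]mul2n -addnn exprD.
have y_le : y ^+ (v * m) <= y.
  by rewrite -[leRHS]expr1 ler_wiXn2l // muln_gt0 vertices_gt0 edgeH.
have zKm : z ^+ (2 * m) <= K ^+ (2 * m) by apply: lerXn2r; rewrite ?nnegrE // (le_trans z0).
rewrite mulrCA [X in _ * X]mulrA.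
apply: ler_pM => //; first exact: exprn_ge0.
  by rewrite !mulr_ge0 ?exprn_ge0.
apply: (@le_trans _ _ (1 * y)); last by rewrite mul1r.
by apply: ler_pM => //; rewrite ?mulr_ge0 ?exprn_ge0.
Qed.

(** Isolates the ratio of the falling factorial to the power as the only dependence of the Poisson
    mean on [#|B|]. *)
Lemma copies_intensity (B : {set U}) (z y : R) : #|B|%:R * y ^+ m = 1 ->
  #|copies H B|%:R * ((z * y ^+ v) ^+ m / m`!%:R) =
  (#|B| ^_ v)%:R / #|B|%:R ^+ v * (z ^+ m / (m`!%:R * a%:R)).
Proof.
move=> yB.
have B0 : (0 < #|B|)%N.
  by rewrite lt0n; apply/negP => /eqP e; move: yB; rewrite e mul0r => /esym/eqP; rewrite oner_eq0.
have /card_gt0P[u0 _] := B0.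
have a0 : a%:R != 0 :> R by rewrite pnatr_eq0 -lt0n automorphisms_gt0.
have b0 : #|B|%:R != 0 :> R by rewrite pnatr_eq0 -lt0n.
have f0 : m`!%:R != 0 :> R by rewrite pnatr_eq0 -lt0n fact_gt0.
have yE : y ^+ m = #|B|%:R^-1 by apply: (mulfI b0); rewrite yB divff.
rewrite -(card_copies H B u0) natrM -/a exprMn exprAC yE exprVn.
have := expf_neq0 v b0; move: a0 f0.
move: (#|copies H B|%:R : R) (a%:R : R) (_ ^+ v) (z ^+ m) (m`!%:R : R).
move=> c a' nv zm f a0 f0 nv0; field.
by rewrite a0 f0 nv0.
Qed.

Lemma prob_escape_gt (B : {set U}) t : (v <= #|B|)%N -> m%:R < t ->
  prob P (escape B t) = 0.
Proof.
move=> vB tm; apply/eqP; rewrite eq_le prob_ge0 andbT.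
have /card_gt0P[u0 _] : (0 < #|B|)%N by apply: leq_trans vB; exact: vertices_gt0.
have /card_gt0P[G GC] : (0 < #|copies H B|)%N.
  have := card_copies H B u0; case: #|copies H B| => // /esym/eqP.
  by rewrite mul0n -leqn0 leqNgt ffact_gt0 vB.
have sE := edges_sub_pairs G.
pose big1 := \big[setU/set0]_(e <- enum (edges G)) [set x | 1 < w e x].
have mgt e : measurable [set x | 1 < w e x].
  rewrite (_ : mkset _ = w e @^-1` `]1, +oo[%classic).
    exact: measurable_preim_RV.
  by apply/seteqP; split => x /=; rewrite in_itv /= andbT.
have mbig : measurable big1 by apply: bigsetU_measurable.
have pbig : prob P big1 = 0.
  apply: prob_bigsetU0 => // e; rewrite mem_enum => /(fintype.subsetP sE).
  exact: (prob_uniform_gt1 unif).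
rewrite -pbig; apply: le_prob => //; first exact: measurable_escape.
move=> x /= /(_ G GC) tw; rewrite /big1 -bigcup_seq; apply: contrapT => no.
have le1 e : e \in edges G -> w e x <= 1.
  move=> eG; rewrite leNgt; apply/negP => we; apply: no; exists e => //=.
  by rewrite mem_enum.
move: tm; apply/negP; rewrite -leNgt (le_trans tw) // /weight.
rewrite (le_trans (ler_sum _ (G := fun=> 1) le1)) // sumr_const.
by rewrite (copies_card_edges GC).
Qed.

End escape.

(** * Tail bound *)

Lemma ffact_ge_exp n k : (2 * k <= n)%N -> (n ^ k <= 2 ^ k * n ^_ k)%N.
Proof.
elim: k => [//|k IH] kn; rewrite ffactnSr !expnS.
have {}IH : (n ^ k <= 2 ^ k * n ^_ k)%N by apply: IH; lia.
have h : (n <= 2 * (n - k))%N by lia.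
by rewrite (leq_trans (leq_mul h IH)) // -!mulnA leq_mul2l /= mulnCA leq_mul2l mulnC leqnn orbT.
Qed.

Lemma expRN_le_inv (R : realType) (x : R) : 0 < x -> expR (- x) <= x^-1.
Proof.
move=> x0; rewrite expRN lef_pV2 ?posrE ?expR_gt0 //.
by rewrite (le_trans _ (expR_ge1Dx x)) // lerDr.
Qed.

Section escape_tail.
Context (R : realType) (d : measure_display) (Omega : measurableType d).
Context (P : probability Omega R) (T U : finType) (H : graph T).
Variable w : {set U} -> {RV P >-> R}.
Let pairs : {set {set U}} := [set e : {set U} | #|e| == 2]%SET.
Hypothesis indep : mutually_independent pairs w.
Hypothesis unif : forall e, e \in pairs -> uniform01 (w e).
Hypothesis balH : strictly_balanced H.
Hypothesis edgeH : (0 < #|edges H|)%N.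
Let m := #|edges H|.
Let v := #|vertices H|.
Let a := #|automorphisms H|.
Let c : R := (2 ^ v * m`! * a + poisson_error H)%:R.

(** With [K = z] and [y = s ^ (2 * m).+1], the Poisson error is a multiple of
    [(z * s) ^ (2 * m) * s <= s]; the exponential of minus the mean [lam] is at most [1 / lam]. *)
Lemma prob_escape_block_le (B : {set U}) (z s : R) : 1 <= z -> 0 < s <= 1 ->
  z * s <= 1 -> #|B|%:R * (s ^+ (2 * m).+1) ^+ m = 1 -> (2 * v <= #|B|)%N ->
  prob P (escape H w B (z * (s ^+ (2 * m).+1) ^+ v)) <=
  (2 ^ v * m`! * a)%:R / z + (poisson_error H)%:R * s.
Proof.
move=> z1 /andP[s0 s1] zs yB vB; set y := s ^+ (2 * m).+1 in yB *.
have v0 : (0 < v)%N := vertices_gt0 edgeH.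
have a0 : (0 < a)%N := automorphisms_gt0 H.
have z0 : 0 < z by exact: lt_le_trans z1.
have y0 : 0 < y by exact: exprn_gt0.
have y1 : y <= 1 by apply: exprn_ile1 => //; exact: ltW.
have zsm : z ^+ (2 * m) * s ^+ (2 * m) <= 1.
  by rewrite -exprMn exprn_ile1 // mulr_ge0 // ltW.
have zy : z * y <= 1.
  rewrite /y exprS mulrA mulr_ile1 ?exprn_ile1 ?exprn_ge0 ?(ltW s0) //.
  by rewrite mulr_ge0 // ltW.
have t1 : z * y ^+ v <= 1.
  rewrite (le_trans _ zy) // ler_wpM2l ?(ltW z0) // -[leRHS]expr1.
  by rewrite ler_wiXn2l // ltW.
have zz : 0 <= z <= z by rewrite ltW //=.
have y01 : 0 <= y <= 1 by rewrite ltW.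
have := poisson_escape indep unif balH edgeH zz z1 y01 yB t1.
rewrite (copies_intensity z yB) ler_distl => /andP[_] /le_trans; apply.
apply: lerD.
  set lam := _ * _.
  have B0 : 0 < #|B|%:R :> R.
    by rewrite ltr0n (leq_trans _ vB) // muln_gt0.
  have fa0 : 0 < m`!%:R * a%:R :> R by rewrite mulr_gt0 // ltr0n ?fact_gt0.
  (* [2 * v <= #|B|] keeps the ratio of the falling factorial to the power above [1 / 2 ^ v], and
     [z <= z ^ m] as [1 <= z]. *)
  have lam_ge : z / (2 ^ v * m`! * a)%:R <= lam.
    rewrite -mulnA natrM invfM mulrCA /lam; apply: ler_pM.
    - by rewrite invr_ge0.
    - by rewrite divr_ge0 // ltW.
    - rewrite ler_pdivlMr ?exprn_gt0 // mulrC ler_pdivrMr ?ltr0n ?expn_gt0 //.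
      by rewrite mulrC -natrX -natrM ler_nat ffact_ge_exp.
    - rewrite natrM ler_pM2r ?invr_gt0 // -[leLHS]expr1.
      exact: ler_weXn2l.
  have q0 : 0 < (2 ^ v * m`! * a)%:R :> R.
    by rewrite ltr0n !muln_gt0 expn_gt0 fact_gt0.
  have l0 : 0 < z / (2 ^ v * m`! * a)%:R by rewrite divr_gt0.
  have lam0 : 0 < lam by exact: lt_le_trans lam_ge.
  rewrite (le_trans (expRN_le_inv lam0)) // -invf_div lef_pV2 //.
rewrite -mulrA ler_wpM2l // /y exprS mulrCA mulrC.
by rewrite (le_trans (ler_wpM2r (ltW s0) zsm)) // mul1r.
Qed.

(** Beyond [z = 1 / s] the probability is bounded by its value at [1 / s], where both terms are of
    order [s]. *)
Lemma prob_escape_block (B : {set U}) (z s : R) : 1 <= z -> 0 < s <= 1 ->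
  #|B|%:R * (s ^+ (2 * m).+1) ^+ m = 1 -> (2 * v <= #|B|)%N ->
  prob P (escape H w B (z * (s ^+ (2 * m).+1) ^+ v)) <= c * Num.max z^-1 s.
Proof.
move=> z1 s01 yB vB; have /andP[s0 s1] := s01.
have z0 : 0 < z by exact: lt_le_trans z1.
rewrite /c natrD mulrDl; have [zs|zs] := leP z^-1 s.
  have siz : s^-1 <= z by rewrite -[leRHS]invrK lef_pV2 ?posrE ?invr_gt0.
  have s1' : 1 <= s^-1 by rewrite invf_ge1.
  have ss : s^-1 * s <= 1 by rewrite mulVf ?gt_eqF.
  have := prob_escape_block_le s1' s01 ss yB vB.
  rewrite invrK; apply: le_trans.
  apply: le_prob; [exact: measurable_escape|exact: measurable_escape|].
  by apply: escape_anti; rewrite ler_wpM2r // !exprn_ge0 // ltW.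
have zs1 : z * s <= 1 by rewrite -(mulfV (lt0r_neq0 z0)) ler_pM2l // ltW.
rewrite (le_trans (prob_escape_block_le z1 s01 zs1 yB vB)) // lerD2l.
by rewrite ler_wpM2l // ltW.
Qed.

Let L := (v * (2 * m).+1)%N.
Let r := (2 * L)%N.

(* A copy weighs at most [m], so [z s ^ L <= m] whenever the escape event has
   positive probability; hence [r] independent blocks turn the weak bound
   [max (1 / z) s] into a quadratic one. *)
Lemma prob_escape_split (k : nat) (B : {set U}) (z s : R) :
  1 <= z -> 0 < s <= 1 -> k%:R * (s ^+ (2 * m).+1) ^+ m = 1 ->
  (2 * v <= k)%N -> (r * k <= #|B|)%N ->
  prob P (escape H w B (z * (s ^+ (2 * m).+1) ^+ v)) <=
  c ^+ r * m%:R ^+ 2 / z ^+ 2.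
Proof.
move=> z1 s01 yk vk kB; have /andP[s0 s1] := s01.
have z0 : 0 < z by exact: lt_le_trans z1.
have v0 : (0 < v)%N := vertices_gt0 edgeH.
have L0 : (0 < L)%N by rewrite muln_gt0 v0.
have m1 : 1 <= m%:R :> R by rewrite ler1n.
have c0 : 0 <= c by [].
set t := z * _.
have [tm|tm] := ltP m%:R t.
  rewrite (prob_escape_gt unif edgeH _ tm).
    by rewrite mulr_ge0 ?invr_ge0 ?exprn_ge0 ?mulr_ge0 ?exprn_ge0 // ltW.
  have kr : (k <= r * k)%N by rewrite leq_pmull // muln_gt0.
  by apply: leq_trans (leq_trans kr kB); apply: leq_trans vk; exact: leq_pmull.
have max0 : 0 <= Num.max z^-1 s by rewrite le_max (ltW s0) orbT.
apply: (@le_trans _ _ ((c * Num.max z^-1 s) ^+ r)).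
  apply: (prob_escape_blocks indep _ _ kB); first by rewrite mulr_ge0.
  by move=> B' kB'; apply: prob_escape_block; rewrite ?kB'.
rewrite exprMn -mulrA ler_wpM2l ?exprn_ge0 //.
have mz : 0 <= m%:R / z by rewrite divr_ge0 // ltW.
rewrite /r mulnC exprM -expr_div_n; apply: lerXn2r; rewrite ?nnegrE ?exprn_ge0 //.
(* The power [L] of the maximum is at most [m / z] in both cases: [s ^ L = t / z] with [t <= m], and
   [(1 / z) ^ L <= 1 / z]. *)
have [zs|zs] := leP z^-1 s.
  by rewrite ler_pdivlMr // mulrC /L mulnC exprM.
apply: (@le_trans _ _ (z^-1)).
  rewrite -[leRHS]expr1 ler_wiXn2l ?invr_ge0 ?(ltW z0) //.
  by rewrite invf_le1.
by rewrite ler_peMl // invr_ge0 ltW.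
Qed.

Lemma exists_root (x : R) (n : nat) : 0 < x -> (0 < n)%N ->
  exists2 s : R, 0 < s & s ^+ n = x.
Proof.
move=> x0 n0; exists (x `^ n%:R^-1); first exact: powR_gt0.
by rewrite -powR_mulrn ?powR_ge0 // -powRrM mulVf ?powRr1 ?(ltW x0) // pnatr_eq0 -lt0n.
Qed.

(** The last factor pays for passing from the scale of [B] to that of a block: their ratio is at
    least [1 / (2 * r)], and it enters to the power [v], then squared. *)
Definition tail_constant : R := c ^+ r * m%:R ^+ 2 * (2 * r)%:R ^+ (2 * v).

Lemma prob_escape_tail (B : {set U}) (zeta y : R) : 0 < zeta -> 0 < y ->
  #|B|%:R * y ^+ m = 1 -> (r * (2 * v) <= #|B|)%N ->
  prob P (escape H w B (zeta * y ^+ v)) <= tail_constant / zeta ^+ 2.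
Proof.
move=> zeta0 y0 yB rB; set n := #|B| in yB rB *.
have v0 : (0 < v)%N := vertices_gt0 edgeH.
have r0 : (0 < r)%N by rewrite /r /L !muln_gt0 v0.
have r2 : (0 < 2 * r)%N by rewrite muln_gt0 r0.
pose k := (n %/ r)%N.
have vk : (2 * v <= k)%N by rewrite leq_divRL // mulnC.
have k0 : (0 < k)%N by rewrite (leq_trans _ vk) // muln_gt0.
have kn : (r * k <= n)%N by rewrite mulnC leq_divM.
have nk : (n <= 2 * r * k)%N.
  have := ltn_ceil n r0; rewrite -/k mulSn => h; rewrite (leq_trans (ltnW h)) //.
  by rewrite -mulnA mul2n -addnn [(k * r)%N]mulnC leq_add2r leq_pmulr.
have m0 : (0 < m)%N := edgeH.
have k0R : 0 < k%:R :> R by rewrite ltr0n.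
have [s s0 sE] : exists2 s : R, 0 < s & s ^+ ((2 * m).+1 * m) = k%:R^-1.
  by apply: exists_root; rewrite ?invr_gt0 // muln_gt0.
have s1 : s <= 1.
  rewrite leNgt; apply/negP => s1.
  have := exprn_ege1 ((2 * m).+1 * m) (ltW s1); rewrite sE.
  have : 1 < s ^+ ((2 * m).+1 * m) by rewrite exprn_egt1 // -lt0n muln_gt0.
  by rewrite sE invf_gt1 // ltNge ler1n k0.
set yk := s ^+ (2 * m).+1.
have ykE : yk ^+ m = k%:R^-1 by rewrite -exprM.
have yk0 : 0 < yk by exact: exprn_gt0.
have ykk : k%:R * yk ^+ m = 1 by rewrite ykE mulfV ?gt_eqF.
have n0R : 0 < n%:R :> R by rewrite ltr0n (leq_trans _ kn) // muln_gt0 r0.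
have yE : y ^+ m = n%:R^-1 by apply: (mulfI (lt0r_neq0 n0R)); rewrite yB mulfV ?gt_eqF.
(* The ratio of the two scales. As [rho <= 1], it is at least [rho ^ m = k / n], itself at least
   [1 / (2 * r)] because [k] is the integer part of [n / r]. *)
pose rho := y / yk.
have rho0 : 0 < rho by exact: divr_gt0.
have rhom : rho ^+ m = k%:R / n%:R by rewrite expr_div_n yE ykE invrK mulrC.
have rho1 : rho <= 1.
  rewrite leNgt; apply/negP => rho1.
  have : 1 < rho ^+ m by rewrite exprn_egt1 // -lt0n.
  rewrite rhom ltr_pdivlMr // mul1r ltr_nat ltnNge (leq_trans _ kn) //.
  by rewrite leq_pmull.
have rho_ge : (2 * r)%:R^-1 <= rho.
  apply: (@le_trans _ _ (rho ^+ m)); last first.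
    by rewrite -[leRHS]expr1 ler_wiXn2l // ltW.
  rewrite rhom ler_pdivlMr // ler_pdivrMl ?ltr0n //.
  by rewrite -natrM ler_nat.
pose z := zeta * rho ^+ v.
have z0 : 0 < z by rewrite mulr_gt0 // exprn_gt0.
have -> : zeta * y ^+ v = z * yk ^+ v.
  by rewrite /z -mulrA -exprMn divfK // gt_eqF.
have cm1 : 1 <= c ^+ r * m%:R ^+ 2.
  have c1 : 1 <= c by rewrite ler1n /poisson_error addnA addnAC addn1.
  by rewrite -[leLHS]mulr1 ler_pM // exprn_ege1 // ler1n.
have le_z : c ^+ r * m%:R ^+ 2 / z ^+ 2 <= tail_constant / zeta ^+ 2.
  rewrite /tail_constant -[leRHS]mulrA; apply: ler_wpM2l.
    by rewrite (le_trans _ cm1).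
  rewrite /z exprMn invfM [leRHS]mulrC; apply: ler_wpM2l.
    by rewrite invr_ge0 exprn_ge0 // ltW.
  rewrite -exprM [(v * 2)%N]mulnC -exprVn; apply: lerXn2r; rewrite ?nnegrE ?invr_ge0 ?(ltW rho0) //.
  by rewrite -[leRHS]invrK lef_pV2 ?posrE ?invr_gt0 // ltr0n.
(* For [z < 1] the claimed bound exceeds 1, as its numerator is at least 1. *)
apply: le_trans le_z; have [z1|z1] := leP 1 z.
  by apply: (prob_escape_split (k := k)); rewrite ?s0.
apply: (@le_trans _ _ 1); first exact/prob_le1/measurable_escape.
rewrite (le_trans cm1) // ler_pdivlMr ?exprn_gt0 // ler_piMr //.
  by rewrite (le_trans _ cm1).
by rewrite exprn_ile1 // ltW.
Qed.

End escape_tail.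

(** * Limits *)

Section weibull_integral.
Context (R : realType) (m : nat) (c : R).
Hypothesis m0 : (0 < m)%N.
Hypothesis c0 : 0 < c.
Let mu := @lebesgue_measure R.
Let q : R := m%:R^-1.
Let k : R := c `^ q.
(** The substitution [z = (c * t) ^ (1 / m)], which turns [z ^ m / c] into [t]; [h] below is its
    derivative on the positive reals. *)
Let F : R -> R := fun t => k * t `^ q.
Let G : R -> R := fun z => expR (- (z ^+ m / c)).
Let h : R -> R := fun t => k * (q * t `^ (q - 1)).

Let q0 : 0 < q. Proof. by rewrite invr_gt0 ltr0n. Qed.
Let k0 : 0 < k. Proof. exact: powR_gt0. Qed.
Let q1 : q - 1 <= 0. Proof. by rewrite subr_le0 invf_le1 ?ltr0n // ler1n. Qed.

Let powRq (t : R) : 0 <= t -> (t `^ q) ^+ m = t.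
Proof.
move=> t0; rewrite -powR_mulrn ?powR_ge0 // -powRrM mulVf ?powRr1 //.
by rewrite pnatr_eq0 -lt0n.
Qed.

Let GF (t : R) : 0 <= t -> G (F t) = expR (- t).
Proof.
by move=> t0; rewrite /G /F exprMn !powRq ?(ltW c0) // mulrAC divff ?gt_eqF // mul1r.
Qed.

Let dF (t : R) : 0 < t -> is_derive t 1 F (h t).
Proof.
move=> t0; have := is_derive1_powR q t0 => d.
exact: (is_deriveZ k d).
Qed.

Let dFE (t : R) : 0 < t -> F^`()%classic t = h t.
Proof. by move=> t0; rewrite derive1E; have [_ ->] := dF t0. Qed.

Let ch (t : R) : 0 < t -> {for t, continuous h}.
Proof.
move=> t0; apply: cvgMr; apply: cvgMr.
by have [/derivable1_diffP/differentiable_continuous] := is_derive1_powR (q - 1) t0.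
Qed.

Let cdF (t : R) : 0 < t -> {for t, continuous F^`()%classic}.
Proof.
move=> t0; rewrite /prop_for /continuous_at dFE //.
apply: cvg_trans (ch t0); apply: near_eq_cvg; near=> x; rewrite dFE //.
by near: x; exact: lt_nbhsr.
Unshelve. all: by end_near. Qed.

Let cF (t : R) : 0 < t -> {for t, continuous F}.
Proof.
by move=> t0; have [/derivable1_diffP/differentiable_continuous] := dF t0.
Qed.

Let cvg_h : cvg (h x @[x --> +oo]).
Proof.
(* When [m = 1] the derivative is constant; otherwise it tends to 0. *)
have [e|qne] := eqVneq (q - 1) 0.
  apply/cvg_ex; exists (k * (q * 1)); rewrite /h e.
  by under eq_fun do rewrite powRr0; exact: cvg_cst.
pose s := 1 - q.
have s0 : 0 < s by rewrite subr_gt0 lt_neqAle -subr_eq0 qne -subr_le0.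
apply/cvg_ex; exists (k * (q * 0)); apply: cvgMr; apply: cvgMr.
apply/cvgrPdist_le => eps eps0; near=> x.
have x0 : 0 < x by near: x; exact: nbhs_pinfty_gt.
rewrite sub0r normrN ger0_norm ?powR_ge0 //.
have -> : q - 1 = - s by rewrite opprB.
rewrite powRN -[leRHS]invrK lef_pV2 ?posrE ?powR_gt0 ?invr_gt0 //.
have -> : eps^-1 = (eps^-1 `^ s^-1) `^ s.
  by rewrite -powRrM mulVf ?gt_eqF // powRr1 // invr_ge0 ltW.
apply: ge0_ler_powR; rewrite ?nnegrE ?powR_ge0 ?(ltW s0) ?(ltW x0) //.
Unshelve. all: by end_near. Qed.

Let Fy : F x @[x --> +oo] --> +oo.
Proof.
apply/cvgryPge => A; near=> x.
have x0 : 0 < x by near: x; exact: nbhs_pinfty_gt.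
rewrite /F -ler_pdivrMl //.
apply: (@le_trans _ _ `|k^-1 * A|); first exact: ler_norm.
have -> : `|k^-1 * A| = (`|k^-1 * A| ^+ m) `^ q.
  by rewrite -powR_mulrn // -powRrM divff ?powRr1 // pnatr_eq0 -lt0n.
apply: ge0_ler_powR; rewrite ?nnegrE ?exprn_ge0 ?(ltW q0) ?(ltW x0) //.
Unshelve. all: by end_near. Qed.

Let cG : continuous G.
Proof.
move=> x; have h1 : {for x, continuous (fun z : R => - (z ^+ m / c))}.
  by apply: cvgN; apply: cvgMl; exact: exprn_continuous.
exact: (continuous_comp h1 (@continuous_expR R _)).
Qed.

(** The derivative of [F] is unbounded near 0 when [m > 1], so the substitution is made away from
    0. *)
Let subst (e : R) : 0 < e ->
  (\int[mu]_(z in `[F e, +oo[) (G z)%:E =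
   \int[mu]_(t in `[e, +oo[) (expR (- t) * h t)%:E)%E.
Proof.
move=> e0; rewrite increasing_ge0_integration_by_substitutiony.
- apply: eq_integral => t; rewrite inE /= in_itv /= andbT => et.
  have t0 : 0 < t by exact: lt_le_trans et.
  by congr EFin; rewrite /= -[LHS]/(G (F t) * F^`()%classic t) dFE // GF // ltW.
- move=> x y; rewrite !in_itv /= !andbT => ex ey xy; rewrite /F ltr_pM2l //.
  by apply: gt0_ltr_powR => //; rewrite nnegrE ltW // (lt_le_trans e0).
- by move=> x; rewrite in_itv /= andbT => ex; apply: cdF; exact: lt_trans ex.
- by apply/cvg_ex; exists (F^`()%classic e); apply: cvg_at_right_filter; exact: cdF.
- have /cvg_ex[l hl] := cvg_h; apply/cvg_ex; exists l; apply: cvg_trans hl.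
  apply: near_eq_cvg; near=> x.
  have x0 : 0 < x by near: x; exact: nbhs_pinfty_gt.
  by rewrite dFE.
- split; last by apply: cvg_at_right_filter; exact: cF.
  move=> x; rewrite in_itv /= andbT => ex.
  by have [] := dF (lt_trans e0 ex).
- exact: Fy.
- exact: continuous_subspaceT.
- by move=> x _; exact: expR_ge0.
Unshelve. all: by end_near. Qed.

Let mG : measurable_fun [set: R] G.
Proof. exact: continuous_measurable_fun.
Qed.

(** The substituted integrals over [[e, +oo[] are passed to the limit by monotone convergence along
    [e = 1 / n.+1]; both families of half-lines exhaust the positive reals. *)
Lemma weibull_integral :
  (\int[mu]_(z in `[0%R, +oo[) (expR (- (z ^+ m / c)))%:E =
   (c `^ q / m%:R)%:E * \int[mu]_(t in `]0%R, +oo[) (t `^ (q - 1) * expR (- t))%:E)%E.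
Proof.
pose e (n : nat) : R := n.+1%:R^-1.
have e0 n : 0 < e n by rewrite invr_gt0.
have e_anti n n' : (n <= n')%N -> e n' <= e n.
  by move=> nn; rewrite lef_pV2 ?posrE // ler_nat.
have e_small (x : R) : 0 < x -> exists n, e n <= x.
  move=> x0; exists (Num.truncn x^-1); rewrite -[leRHS]invrK lef_pV2 ?posrE ?invr_gt0 //.
  by rewrite ltW // truncnS_gt.
have Fpos (t : R) : 0 < t -> 0 < F t by move=> t0; rewrite mulr_gt0 // powR_gt0.
have Fmono (t t' : R) : 0 < t -> t <= t' -> F t <= F t'.
  move=> t0 tt; rewrite ler_pM2l //; apply: ge0_ler_powR; rewrite ?nnegrE ?(ltW q0) //.
    exact: ltW.
  by rewrite (le_trans (ltW t0)).
pose D : set R := `]0, +oo[%classic.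
have mh : measurable_fun D (fun t : R => expR (- t) * h t).
  apply: open_continuous_measurable_fun.
    exact: interval_open.
  move=> t; rewrite inE /D /= in_itv /= andbT => t0; apply: cvgM; last exact: ch.
  have h1 : {for t, continuous (fun z : R => - z)} by apply: cvgN; exact: cvg_id.
  exact: (continuous_comp h1 (@continuous_expR R _)).
pose S1 n : set R := `[F (e n), +oo[%classic.
pose S2 n : set R := `[e n, +oo[%classic.
have U1 : \bigcup_n S1 n = D.
  apply/seteqP; split => z; rewrite /D /=.
    by case=> n _; rewrite /S1 /= !in_itv /= !andbT; apply: lt_le_trans; exact: Fpos.
  rewrite in_itv /= andbT => z0.
  (* [F] maps [z ^ m / c] to [z]. *)
  have [|n hn] := e_small (z ^+ m / c); first by rewrite divr_gt0 // exprn_gt0.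
  exists n => //; rewrite /S1 /= in_itv /= andbT.
  apply: (le_trans (Fmono _ _ (e0 n) hn)).
  have zc0 : 0 <= z ^+ m / c by rewrite divr_ge0 ?exprn_ge0 ?ltW.
  rewrite /F /k -powRM ?(ltW c0) // mulrCA divff ?gt_eqF // mulr1.
  have mq : m%:R * q = 1 by rewrite divff // pnatr_eq0 -lt0n.
  by rewrite -powR_mulrn ?(ltW z0) // -powRrM mq powRr1 // ltW.
have U2 : \bigcup_n S2 n = D.
  apply/seteqP; split => z; rewrite /D /=.
    by case=> n _; rewrite /S2 /= !in_itv /= !andbT; apply: lt_le_trans.
  rewrite in_itv /= andbT => /e_small[n hn].
  by exists n => //; rewrite /S2 /= in_itv /= andbT.
have sub0 (x : R) : 0 < x -> `[x, +oo[%classic `<=` D.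
  by move=> x0 z; rewrite /D /= !in_itv /= !andbT; exact: lt_le_trans.
have lim1 : (\int[mu]_(z in S1 n) (G z)%:E @[n --> \oo] -->
    \int[mu]_(z in D) (G z)%:E)%E.
  rewrite -U1; apply: ge0_nondecreasing_set_cvg_integral => //.
  - move=> n n' nn; rewrite subsetEset => z; rewrite /S1 /= !in_itv /= !andbT.
    by apply: le_trans; apply: Fmono => //; exact: e_anti.
  - by move=> n; exact: measurable_itv.
  - by move=> n; apply/measurable_EFinP; exact: measurable_funTS.
  - by move=> n x _; rewrite lee_fin expR_ge0.
have lim2 : (\int[mu]_(t in S2 n) (expR (- t) * h t)%:E @[n --> \oo] -->
    \int[mu]_(t in D) (expR (- t) * h t)%:E)%E.
  rewrite -U2; apply: ge0_nondecreasing_set_cvg_integral => //.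
  - move=> n n' nn; rewrite subsetEset => z; rewrite /S2 /= !in_itv /= !andbT.
    by apply: le_trans; exact: e_anti.
  - by move=> n; exact: measurable_itv.
  - by move=> n; apply/measurable_EFinP; apply: measurable_funS mh; [exact: measurable_itv|exact: sub0].
  - by move=> n x _; rewrite lee_fin !mulr_ge0 ?expR_ge0 ?powR_ge0 // ltW.
have -> : (\int[mu]_(z in `[0%R, +oo[) (G z)%:E = \int[mu]_(z in D) (G z)%:E)%E.
  by rewrite -integral_itv_obnd_cbnd //; apply/measurable_EFinP; exact: measurable_funTS.
have -> : (\int[mu]_(z in D) (G z)%:E = \int[mu]_(t in D) (expR (- t) * h t)%:E)%E.
  apply: cvg_unique lim1 _ => //; have lim2' := lim2.
  suff -> : (fun n => \int[mu]_(z in S1 n) (G z)%:E)%E =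
      (fun n => \int[mu]_(t in S2 n) (expR (- t) * h t)%:E)%E by [].
  by apply/funext => n; exact: subst.
have kq0 : 0 < k * q by exact: mulr_gt0.
have hE (t : R) : expR (- t) * h t = k * q * (t `^ (q - 1) * expR (- t)).
  by rewrite /h; ring.
have mg : measurable_fun D (fun t : R => t `^ (q - 1) * expR (- t)).
  have -> : (fun t : R => t `^ (q - 1) * expR (- t)) =
      (fun t => (k * q)^-1 * (expR (- t) * h t)).
    by apply/funext => t; rewrite hE mulKf // gt_eqF.
  exact: (measurable_funM (measurable_cst _) mh).
rewrite -/k -/q -ge0_integralZl //=.
- by apply: eq_integral => t _; rewrite hE.
- exact/measurable_EFinP.
- by move=> t _; rewrite lee_fin mulr_ge0 ?powR_ge0 ?expR_ge0.
- by rewrite lee_fin ltW.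
Qed.

End weibull_integral.

(** The ratio is the product of the factors [1 - j / n] for [j < k]; each costs at most [j / n], and
    the costs add up to at most [k ^ 2 / n]. *)
Lemma ffact_ratio_ge (R : realFieldType) (n k : nat) : (0 < n)%N ->
  (1 - (k ^ 2)%:R / n%:R : R) <= (n ^_ k)%:R / n%:R ^+ k <= (1 : R).
Proof.
move=> n0; have n0R : 0 < n%:R :> R by rewrite ltr0n.
have le1 j : (n ^_ j)%:R / n%:R ^+ j <= 1 :> R.
  by rewrite ler_pdivrMr ?exprn_gt0 // mul1r -natrX ler_nat ffact_le_exp.
apply/andP; split; last exact: le1.
elim: k => [|k IH]; first by rewrite ffactn0 expr0 divr1 mul0r subr0.
set th := (n ^_ k)%:R / _ in IH.
have th0 : 0 <= th by rewrite divr_ge0 ?exprn_ge0.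
have th1 : th <= 1 by exact: le1.
have -> : (n ^_ k.+1)%:R / n%:R ^+ k.+1 = th * ((n - k)%N%:R / n%:R) :> R.
  by rewrite ffactnSr natrM exprSr invfM mulrACA.
have h : 1 - k%:R / n%:R <= (n - k)%N%:R / n%:R :> R.
  by rewrite lerBlDr -mulrDl ler_pdivlMr // mul1r -natrD ler_nat; lia.
apply: (@le_trans _ _ (th * (1 - k%:R / n%:R))); last by rewrite ler_wpM2l.
have e : (k.+1 ^ 2)%:R / n%:R = (k ^ 2)%:R / n%:R + k%:R / n%:R + k.+1%:R / n%:R :> R.
  by rewrite -!mulrDl -!natrD; congr (_%:R / _); lia.
have kn0 : 0 <= k%:R / n%:R :> R by rewrite divr_ge0 // ltW.
have kn1 : 0 <= k.+1%:R / n%:R :> R by rewrite divr_ge0 // ltW.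
have : th * (k%:R / n%:R) <= k%:R / n%:R by rewrite ler_piMl.
rewrite mulrBr mulr1 e; lra.
Qed.

Lemma dist_expRN_le (R : realType) (x th : R) : 0 <= x -> 0 <= th <= 1 ->
  `|expR (- (th * x)) - expR (- x)| <= (1 - th) * x.
Proof.
move=> x0 th01; have /andP[th0 th1] := th01.
have thx : th * x <= x by rewrite ler_piMl.
have e1 : expR (- (th * x)) <= 1 by rewrite -[leRHS]expR0 ler_expR oppr_le0 mulr_ge0.
rewrite ger0_norm; last by rewrite subr_ge0 ler_expR lerN2.
have -> : expR (- x) = expR (- (th * x)) * expR (- ((1 - th) * x)).
  by rewrite -expRD; congr expR; ring.
rewrite -{1}[expR (- (th * x))]mulr1 -mulrBr.
have h := expR_ge1Dx (- ((1 - th) * x)).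
have y0 : 0 <= (1 - th) * x by rewrite mulr_ge0 // subr_ge0.
have e2 : expR (- ((1 - th) * x)) <= 1 by rewrite -[leRHS]expR0 ler_expR oppr_le0.
apply: (@le_trans _ _ (1 * (1 - expR (- ((1 - th) * x))))).
  by rewrite ler_wpM2r // subr_ge0.
by rewrite mul1r lerBlDl -lerBlDr.
Qed.

Section scaled_tail.
Context (R : realType) (d : measure_display) (Omega : measurableType d).
Variable P : probability Omega R.
Let mu := @lebesgue_measure R.

(** The layer-cake formula for the positive part of [X] divided by [s], which agrees with [X / s]
    off a null event. The function [f] is its tail function, so its measurability on the whole line
    comes for free. *)
Lemma expectation_scaled_tail (X : Omega -> R) (s : R) :
  measurable_fun setT X -> 0 < s -> prob P [set x | X x < 0] = 0 ->
  exists f : R -> R, [/\ measurable_fun setT f,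
    forall r, 0 <= r -> f r = prob P [set x | r * s < X x] &
    ('E_P[X] = s%:E * \int[mu]_(r in `[0%R, +oo[) (f r)%:E)%E].
Proof.
move=> mX s0 X0.
pose Y0 := fun x => Num.max (X x) 0 / s.
have mY : measurable_fun setT Y0.
  apply: measurable_funM; last exact: measurable_cst.
  by apply: measurable_maxr => //; exact: measurable_cst.
pose Y : {RV P >-> R} := mfun_Sub (mem_set mY).
have Yge0 x : 0 <= Y x.
  by apply: divr_ge0; [rewrite le_max lexx orbT|exact: ltW].
exists (fun r => fine (ccdf Y r)); split.
- apply: measurableT_comp; first exact: fine_measurable.
  exact: ccdf_measurable.
- move=> r r0; rewrite /ccdf /distribution /= /pushforward /prob; congr (fine (P _)).
  apply/seteqP; split => x /=; rewrite in_itv /= andbT /Y0 ltr_pdivlMr //.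
    by rewrite lt_max => /orP[//|]; rewrite ltNge mulr_ge0 // ltW.
  by move=> h; rewrite lt_max h.
have -> : ('E_P[X] = s%:E * 'E_P[Y])%E.
  rewrite unlock -ge0_integralZl //=; last 3 first.
  - exact/measurable_EFinP.
  - by move=> x _; rewrite lee_fin; exact: Yge0.
  - by rewrite lee_fin ltW.
  apply: ae_eq_integral => //.
  - exact/measurable_EFinP.
  - apply/measurable_EFinP; apply: measurable_funM => //; exact: measurable_cst.
  have mX0 : measurable [set x | X x < 0].
    rewrite -[mkset _]setTI (_ : mkset _ = X @^-1` `]-oo, 0[%classic).
      by apply: mX => //; exact: measurable_itv.
    by apply/seteqP; split => x /=; rewrite in_itv.
  exists [set x | X x < 0]; split => //.
  + exact: etrans (probE P mX0) (congr1 EFin X0).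
  + move=> x /= h; rewrite ltNge; apply/negP => Xx; apply: h => _ /=.
    by rewrite -EFinM /Y0 mulrCA divff ?gt_eqF // mulr1 max_l.
rewrite ge0_expectation_ccdf //; congr (_ * _)%E; apply: eq_integral => r _.
by rewrite fineK // /ccdf fin_num_measure.
Qed.

End scaled_tail.

Lemma fineZ_gt0 (R : realType) (k : R) (x : \bar R) : 0 < k ->
  fine (k%:E * x)%E = k * fine x.
Proof.
by case: x => [x| |] k0 //=; rewrite ?gt0_muley ?gt0_muleNy ?lte_fin //= mulr0.
Qed.

Lemma dist_squeeze (R : realFieldType) (x p q F G e : R) :
  x <= p -> q <= x -> `|p - F| <= e / 2 -> `|q - G| <= e / 2 ->
  `|F - G| <= e / 2 -> `|F - x| <= e.
Proof.
move=> xp qx; rewrite !ler_norml => /andP[? ?] /andP[? ?] /andP[? ?].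
by apply/andP; split; lra.
Qed.

(** * Limit law and expectation of the minimum weight *)

Section minimum_weight.
Context (R : realType) (T : finType) (H : graph T).
Hypothesis balH : strictly_balanced H.
Hypothesis edgeH : (0 < #|edges H|)%N.
Context (disp : nat -> measure_display).
Context (Omega : forall n : nat, measurableType (disp n)).
Context (P : forall n : nat, probability (Omega n) R).
Context (w : forall n : nat, {set 'I_n} -> {RV (P n) >-> R}).
Arguments w : clear implicits.
Hypothesis w_uniform : forall (n : nat) (e : {set 'I_n}),
  e \in edges (complete_graph n) -> uniform01 (w n e).
Hypothesis w_indep : forall n : nat,
  mutually_independent (edges (complete_graph n)) (w n).
Let m := #|edges H|.
Let v := #|vertices H|.
Let a := #|automorphisms H|.
Let c : R := m`!%:R * a%:R.
Let W (n : nat) (x : Omega n) : R :=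
  min_weight H (complete_graph n) (fun e => w n e x).
Arguments W : clear implicits.

(* The scale [n ^ (- 1 / m)], of which [n ^ (- 1 / d)] is the [v]-th power. *)
Let y (n : nat) : R := n%:R `^ (- m%:R^-1).

Let m0 : (0 < m)%N. Proof. exact: edgeH. Qed.
Let v0 : (0 < v)%N. Proof. exact: vertices_gt0 edgeH. Qed.
Let c0 : 0 < c.
Proof. by rewrite mulr_gt0 // ltr0n ?fact_gt0 // automorphisms_gt0. Qed.

Lemma scaleX n : (0 < n)%N -> n%:R * y n ^+ m = 1.
Proof.
move=> n0; rewrite -powR_mulrn ?powR_ge0 // -powRrM mulNr mulVf; last first.
  by rewrite pnatr_eq0 -lt0n.
by rewrite powR_inv1 // divff // pnatr_eq0 -lt0n.
Qed.

Lemma scale_gt0 n : (0 < n)%N -> 0 < y n.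
Proof. by move=> n0; rewrite powR_gt0 // ltr0n. Qed.

Lemma scale_le1 n : (0 < n)%N -> y n <= 1.
Proof.
move=> n0; rewrite leNgt; apply/negP => y1.
have : 1 < n%:R * y n ^+ m.
  rewrite -[ltLHS]mulr1 -[X in X * 1](_ : 1 = 1%:R :> R) //.
  apply: (@lt_le_trans _ _ (1 * y n ^+ m)); first by rewrite !mul1r exprn_egt1 // -lt0n.
  by rewrite ler_pM2r ?exprn_gt0 ?scale_gt0 // ler1n.
by rewrite scaleX // ltxx.
Qed.

Lemma inv_natV_le_scale n : (0 < n)%N -> n%:R^-1 <= y n.
Proof.
move=> n0; have -> : n%:R^-1 = y n ^+ m.
  have nn0 : n%:R != 0 :> R by rewrite pnatr_eq0 -lt0n.
  by apply: (mulfI nn0); rewrite scaleX // mulfV.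
rewrite -[leRHS]expr1 ler_wiXn2l ?scale_le1 //; exact: ltW (scale_gt0 n0).
Qed.

Lemma scale_small (e : R) : 0 < e -> \forall n \near \oo, y n <= e.
Proof.
move=> e0; near=> n.
have n0 : (0 < n)%N by near: n; exact: nbhs_infty_gt.
have en : (e^-1 ^+ m) <= n%:R.
  by near: n; exact: nbhs_infty_ger.
have {}en : 1 <= n%:R * e ^+ m.
  by rewrite -ler_pdivrMr ?exprn_gt0 // mul1r -exprVn.
rewrite leNgt; apply/negP => ey.
have : e ^+ m < y n ^+ m by rewrite ltrXn2r // -?lt0n // ltW.
by rewrite -(ltr_pM2l (_ : 0 < n%:R)) ?ltr0n // scaleX // ltNge en.
Unshelve. all: by end_near. Qed.

Let d : R := ratr (den H).

Lemma invdE : 1 / d = v%:R / m%:R.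
Proof. by rewrite /d /den fmorph_div /= !ratr_nat div1r invf_div. Qed.

Lemma powR_invd n : n%:R `^ (- (1 / d)) = y n ^+ v.
Proof.
by rewrite invdE -powR_mulrn ?powR_ge0 // -powRrM mulNr [_^-1 * _]mulrC.
Qed.

Lemma div_powR_invd n z : z / n%:R `^ (1 / d) = z * y n ^+ v.
Proof. by rewrite -powRN powR_invd. Qed.

Let F (z : R) := expR (- (z ^+ m / c)).
Let esc n z := escape H (w n) [set: 'I_n]%SET (z * y n ^+ v).
Arguments esc : clear implicits.
Let p n z := prob (P n) (esc n z).

Let cardT n : #|[set: 'I_n]%SET| = n. Proof. by rewrite cardsT card_ord. Qed.

Lemma subgraph_complete n (G : graph 'I_n) : subgraph G (complete_graph n).
Proof.
rewrite /subgraph; apply/andP; split; first exact: finset.subsetT.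
by apply/fintype.subsetP => e eG; rewrite inE (card_edge eG).
Qed.

Lemma copies_complete n (G : graph 'I_n) :
  (G \in copies H [set: 'I_n]%SET) <->
  subgraph G (complete_graph n) /\ isomorphic H G.
Proof.
split; first by case/copiesP => iG _; split=> //; exact: subgraph_complete.
by case=> _ iG; apply/copiesP; split => //; exact: finset.subsetT.
Qed.

Lemma exists_copy n : (v <= n)%N ->
  exists G : graph 'I_n, subgraph G (complete_graph n) /\ isomorphic H G.
Proof.
move=> vn; have n0 : (0 < n)%N by exact: leq_trans vn.
have /card_gt0P[G GC] : (0 < #|copies H [set: 'I_n]%SET|)%N.
  have := card_copies H [set: 'I_n]%SET (Ordinal n0).
  case: #|copies H _| => // /esym/eqP.
  by rewrite mul0n -leqn0 leqNgt ffact_gt0 cardT vn.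
by exists G; apply/copies_complete.
Qed.

(** With at least [v] vertices a copy exists and the infimum is attained; with fewer, [min_weight]
    takes its default value 0. *)
Lemma min_weight_ge n t : (v <= n)%N ->
  [set x | t <= W n x] = escape H (w n) [set: 'I_n]%SET t.
Proof.
move=> vn; apply/seteqP; split => x; rewrite /escape /W /= => h.
  have [G0 [_ _ e minG]] := min_weightP (fun e => w n e x) (exists_copy vn).
  move=> G /copies_complete[sG iG]; rewrite (le_trans h) // e; exact: minG.
have [G0 [sG iG -> _]] := min_weightP (fun e => w n e x) (exists_copy vn).
by apply: h; apply/copies_complete.
Qed.

Lemma min_weight_ge_scaled n z : (v <= n)%N ->
  [set x | z * y n ^+ v <= W n x] = esc n z.
Proof. exact: min_weight_ge. Qed.

Lemma F_anti z z' : 0 <= z -> z <= z' -> F z' <= F z.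
Proof.
move=> z0 zz; rewrite ler_expR lerN2 ler_pM2r ?invr_gt0 //.
by apply: lerXn2r; rewrite ?nnegrE // (le_trans z0).
Qed.

Lemma p_anti n z z' : (0 < n)%N -> z <= z' -> p n z' <= p n z.
Proof.
move=> n0 zz; apply: le_prob; [exact: measurable_escape|exact: measurable_escape|].
by apply: escape_anti; rewrite ler_wpM2r // exprn_ge0 // ltW // scale_gt0.
Qed.

(** Two errors add up: the Poisson approximation, and the replacement of the exact mean by its
    limit, which costs a multiple of [1 / n = y n ^ m <= y n]. *)
Lemma p_dist n z K : (0 < n)%N -> 1 <= K -> K * y n <= 1 -> 0 <= z <= K ->
  `|p n z - F z| <=
    ((poisson_error H)%:R * K ^+ (2 * m) + (v ^ 2)%:R * (K ^+ m / c)) * y n.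
Proof.
move=> n0 K1 Ky zK; have /andP[z0 zK'] := zK.
have y0 := scale_gt0 n0; have y1 := scale_le1 n0.
have K0 : 0 <= K by exact: le_trans K1.
have yB : #|[set: 'I_n]%SET|%:R * y n ^+ m = 1 by rewrite cardT scaleX.
have t1 : z * y n ^+ v <= 1.
  apply: le_trans Ky; apply: ler_pM => //; first by rewrite exprn_ge0 // ltW.
  by rewrite -[leRHS]expr1 ler_wiXn2l // ltW.
have y01 : 0 <= y n <= 1 by rewrite ltW.
have := poisson_escape (@w_indep n) (@w_uniform n) balH edgeH zK K1 y01 yB t1.
rewrite (copies_intensity z yB) cardT -/c -/m => h1.
have th := ffact_ratio_ge R v n0.
have th0 : 0 <= (n ^_ v)%:R / n%:R ^+ v :> R by rewrite divr_ge0 ?exprn_ge0.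
have x0 : 0 <= z ^+ m / c by rewrite divr_ge0 ?exprn_ge0 // ltW.
have th01 : 0 <= ((n ^_ v)%:R / n%:R ^+ v : R) <= 1.
  by apply/andP; split; [exact: th0|case/andP: th].
have h2 := dist_expRN_le x0 th01.
apply: (le_trans (ler_distD (expR (- ((n ^_ v)%:R / n%:R ^+ v * (z ^+ m / c)))) _ _)).
rewrite mulrDl; apply: lerD; first exact: h1.
rewrite (le_trans h2) //.
apply: (@le_trans _ _ ((v ^ 2)%:R / n%:R * (K ^+ m / c))).
  apply: ler_pM => //; first by rewrite subr_ge0; case/andP: th01.
    by case/andP: th => h _; rewrite lerBlDr addrC -lerBlDr.
  by rewrite ler_pM2r ?invr_gt0 // lerXn2r // nnegrE.
rewrite mulrAC; apply: ler_wpM2l; last exact: inv_natV_le_scale.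
by rewrite mulr_ge0 // divr_ge0 ?exprn_ge0 // ltW.
Qed.

(** Uniformity in [z] is what allows [z] to vary with [n]. *)
Lemma p_near (K e : R) : 1 <= K -> 0 < e ->
  \forall n \near \oo, forall z, 0 <= z <= K -> `|p n z - F z| <= e.
Proof.
move=> K1 e0; set D := (poisson_error H)%:R * K ^+ (2 * m) + (v ^ 2)%:R * (K ^+ m / c).
have K0 : 0 < K by exact: lt_le_trans K1.
have D0 : 0 <= D.
  by rewrite addr_ge0 // mulr_ge0 ?divr_ge0 ?exprn_ge0 // ltW.
near=> n => z zK.
have n0 : (0 < n)%N by near: n; exact: nbhs_infty_gt.
have yD : y n <= e / (D + 1).
  by near: n; apply: scale_small; rewrite divr_gt0 // ltr_wpDl.
have yK : y n <= K^-1 by near: n; apply: scale_small; rewrite invr_gt0.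
apply: le_trans (p_dist n0 K1 _ zK) _.
  by rewrite mulrC -ler_pdivlMr // mul1r.
rewrite -/D (le_trans (ler_wpM2l D0 yD)) // mulrCA ler_piMr ?(ltW e0) //.
by rewrite ler_pdivrMr ?ltr_wpDl // mul1r lerDl.
Unshelve. all: by end_near. Qed.

Lemma F_small (e : R) : 0 < e -> exists2 K, 1 <= K & F K <= e.
Proof.
(* From [expR (- x) <= 1 / x] and [K <= K ^ m] follows [F K <= c / K <= e]. *)
move=> e0; exists (Num.max 1 (c / e)); first by rewrite le_max lexx.
set K := Num.max _ _.
have K1 : 1 <= K by rewrite le_max lexx.
have K0 : 0 < K by exact: lt_le_trans K1.
have x0 : 0 < K ^+ m / c by rewrite divr_gt0 // exprn_gt0.
rewrite (le_trans (expRN_le_inv x0)) // invf_div ler_pdivrMr ?exprn_gt0 //.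
rewrite mulrC -ler_pdivrMr // (@le_trans _ _ K) //; first by rewrite le_max lexx orbT.
by rewrite -[leLHS]expr1 ler_weXn2l.
Qed.

Lemma min_weight_distribution (z : nat -> R) : (forall n, 0 <= z n) ->
  fine (P n [set x | z n / n%:R `^ (1 / d) <= W n x])
    - expR (- (z n ^+ m / (m`!%:R * a%:R))) @[n --> \oo] --> (0 : R).
Proof.
move=> z0; apply/cvgrPdist_le => e e0.
have e20 : 0 < e / 2 by rewrite divr_gt0.
have [K K1 FK] := F_small e20.
have nearK := p_near K1 e20.
near=> n.
have vn : (v <= n)%N by near: n; exact: nbhs_infty_ge.
have n0 : (0 < n)%N by exact: leq_trans vn.
have near_n : forall z, 0 <= z <= K -> `|p n z - F z| <= e / 2.
  by near: n; exact: nearK.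
rewrite sub0r normrN div_powR_invd min_weight_ge_scaled // -[fine _]/(p n (z n)).
rewrite -[expR _]/(F (z n)).
(* The sequence may be unbounded: beyond [K] both quantities lie between 0 and their values at [K],
   which are at most [e]. *)
have [zK|zK] := leP (z n) K.
  by rewrite (le_trans (near_n _ _)) ?z0 // ler_pdivrMr // ler_peMr ?ler1n // ltW.
have K0 : 0 <= K by exact: le_trans K1.
have := near_n K; rewrite lexx K0 => /(_ isT) hK.
have pz : p n (z n) <= p n K by exact: p_anti (ltW zK).
have Fz : F (z n) <= F K by exact: F_anti (ltW zK).
have p0 : 0 <= p n (z n) by exact: prob_ge0.
have F0 : 0 <= F (z n) by exact: expR_ge0.
move: pz Fz p0 F0 hK FK; move: (p n (z n)) (p n K) (F (z n)) (F K) => p1 p2 f1 f2.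
by rewrite !ler_norml => ? ? ? ? /andP[_ ?] ?; apply/andP; split; lra.
Unshelve. all: by end_near. Qed.

(** With this many vertices, each block of the tail bound has at least [2 * v] of them. *)
Let block_threshold : nat := (2 * (v * (2 * m).+1) * (2 * v))%N.

Lemma le_block_threshold : (v <= block_threshold)%N.
Proof. by rewrite /block_threshold -!mulnA mulnCA leq_pmulr // !muln_gt0 v0. Qed.

Lemma measurable_min_weight n : (v <= n)%N -> measurable_fun setT (W n).
Proof.
move=> vn mT; apply: (measurability _ (RGenCInfty.measurableE R)) => //.
move=> _ [_ [t ->] <-]; rewrite setTI.
rewrite (_ : _ @^-1` _ = [set x | t <= W n x]).
  by rewrite min_weight_ge //; exact: measurable_escape.
by apply/seteqP; split => x /=; rewrite in_itv /= andbT.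
Qed.

Lemma measurable_min_weight_gt n t : (v <= n)%N -> measurable [set x | t < W n x].
Proof.
move=> vn; rewrite -[mkset _]setTI (_ : mkset _ = W n @^-1` `]t, +oo[%classic).
  by apply: measurable_min_weight => //; exact: measurable_itv.
by apply/seteqP; split => x /=; rewrite in_itv /= andbT.
Qed.

Lemma min_weight_lt0 n : (v <= n)%N -> prob (P n) [set x | W n x < 0] = 0.
Proof.
move=> vn; pose E := edges (complete_graph n).
pose neg := \big[setU/set0]_(e <- enum E) [set x | w n e x < 0].
have mneg : measurable neg.
  by apply: bigsetU_measurable => e _; exact: measurable_RV_lt.
have neg0 : prob (P n) neg = 0.
  apply: prob_bigsetU0 => [e|e]; first exact: measurable_RV_lt.
  by rewrite mem_enum; exact: (prob_uniform_lt0 (@w_uniform n)).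
apply/eqP; rewrite eq_le prob_ge0 andbT -[leRHS]neg0; apply: le_prob => //.
  rewrite (_ : mkset _ = ~` [set x | 0 <= W n x]).
    by rewrite min_weight_ge //; apply: measurableC; exact: measurable_escape.
  apply/seteqP; split => x /= h; first by rewrite leNgt h.
  by rewrite ltNge; apply/negP.
move=> x /=; apply: contraPP => no; apply/negP; rewrite -leNgt /W.
have [G [sG iG -> _]] := min_weightP (fun e => w n e x) (exists_copy vn).
apply: sumr_ge0 => e eG; rewrite leNgt; apply/negP => we; apply: no.
rewrite /neg -bigcup_seq; exists e => //=; rewrite mem_enum.
by case/andP: sG => _ /fintype.subsetP; apply.
Qed.

(** The quadratic decay and, near 0, the trivial bound 1 are merged into a multiple of
    [1 / (1 + z ^ 2)], which is integrable on the half-line and dominates for all large [n] at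
    once. *)
Lemma tail_bound : exists2 C : R, 0 <= C & forall n z,
  (block_threshold <= n)%N -> 0 <= z -> p n z <= C * (oneDsqr z)^-1.
Proof.
have [D D0 hD] : exists2 D : R, 0 <= D & forall n z, (block_threshold <= n)%N ->
    0 < z -> p n z <= D / z ^+ 2.
  exists (tail_constant R H); first by rewrite !mulr_ge0.
  move=> n z tn zp.
  have n0 : (0 < n)%N by exact: leq_trans (leq_trans le_block_threshold tn).
  apply: (prob_escape_tail (@w_indep n) (@w_uniform n) balH edgeH zp (scale_gt0 n0)).
    by rewrite cardT scaleX.
  by rewrite cardT.
exists (2 * (1 + D)); first by rewrite mulr_ge0 // addr_ge0.
move=> n z tn z0.
have q0 : 0 < oneDsqr z := lt_le_trans ltr01 (oneDsqr_ge1 z).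
rewrite ler_pdivlMr //; have [z1|z1] := leP z 1.
  have zz : oneDsqr z <= 2.
    by rewrite /oneDsqr (_ : 2 = 1 + 1 :> R) // lerD2l exprn_ile1.
  apply: (@le_trans _ _ (1 * 2)); last by rewrite mul1r ler_peMr // lerDl.
  apply: ler_pM; [exact: prob_ge0|exact: ltW| |exact: zz].
  by apply: prob_le1; exact: measurable_escape.
have zp : 0 < z by exact: lt_trans z1.
have zz : oneDsqr z <= 2 * z ^+ 2.
  by rewrite /oneDsqr mulr_natl mulr2n lerD2r exprn_ege1 // ltW.
apply: (le_trans (ler_pM (prob_ge0 _ _) (ltW q0) (hD n z tn zp) zz)).
rewrite mulrCA divfK; last by rewrite expf_neq0 // gt_eqF.
by rewrite ler_pM2l // lerDr.
Qed.

Lemma F_continuous : continuous F.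
Proof.
move=> x; have h1 : {for x, continuous (fun z : R => - (z ^+ m / c))}.
  by apply: cvgN; apply: cvgMl; exact: exprn_continuous.
exact: (continuous_comp h1 (@continuous_expR R _)).
Qed.

(** The layer-cake formula involves the strict tail, whereas [p] is the non-strict one. The strict
    tail at [r] lies between [p n (r + y n)] and [p n r], and [F] is continuous. *)
Lemma cvg_prob_gt (r : R) : 0 <= r ->
  prob (P n) [set x | r * y n ^+ v < W n x] @[n --> \oo] --> F r.
Proof.
move=> r0; apply/cvgrPdist_le => e e0.
have e20 : 0 < e / 2 by rewrite divr_gt0.
have r1 : 1 <= r + 1 by rewrite lerDr.
have nearK := p_near r1 e20.
have /cvgrPdist_le/(_ _ e20) := @F_continuous r.
move=> /nbhs_ballP[/= dl dl0 hdl].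
have dl20 : 0 < dl / 2 by rewrite divr_gt0.
near=> n.
have vn : (v <= n)%N by near: n; exact: nbhs_infty_ge.
have n0 : (0 < n)%N by exact: leq_trans vn.
have yd : y n <= dl / 2 by near: n; exact: scale_small.
have near_n : forall z, 0 <= z <= r + 1 -> `|p n z - F z| <= e / 2.
  by near: n; exact: nearK.
have y0 := scale_gt0 n0; have y1 := scale_le1 n0.
have yv0 : 0 < y n ^+ v by rewrite exprn_gt0.
(* The shift [y n] tends to 0 and, being at most 1, keeps [r + y n] in the range [[0, r + 1]] of the
   uniform estimate. *)
have Fr : `|F r - F (r + y n)| <= e / 2.
  apply: hdl; rewrite /ball /= opprD addNKr normrN gtr0_norm //.
  by rewrite (le_lt_trans yd) // ltr_pdivrMr // ltr_pMr // ltr1n.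
have up : prob (P n) [set x | r * y n ^+ v < W n x] <= p n r.
  rewrite /p -min_weight_ge_scaled //; apply: le_prob.
  - exact: measurable_min_weight_gt.
  - by rewrite min_weight_ge_scaled //; exact: measurable_escape.
  - by move=> x /= /ltW.
have low : p n (r + y n) <= prob (P n) [set x | r * y n ^+ v < W n x].
  rewrite /p -min_weight_ge_scaled //; apply: le_prob.
  - by rewrite min_weight_ge_scaled //; exact: measurable_escape.
  - exact: measurable_min_weight_gt.
  - by move=> x /=; apply: lt_le_trans; rewrite ltr_pM2r // ltrDl.
have := near_n r; rewrite r0 lerDl ler01 => /(_ isT) h1.
have := near_n (r + y n); rewrite addr_ge0 ?(ltW y0) // lerD2l y1 => /(_ isT) h2.
exact: dist_squeeze up low h1 h2 Fr.
Unshelve. all: by end_near. Qed.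

Let mu := @lebesgue_measure R.
Let pos : set R := `[0, +oo[%classic.

(** Dominated convergence of the rescaled tails. Positivity of the limit is recorded because the
    asymptotic equivalence divides by it. *)
Lemma expectation_min_weight :
  exists I : R, [/\ (\int[mu]_(r in pos) (F r)%:E = I%:E)%E, 0 < I &
    fine ('E_(P n)[W n]) / y n ^+ v @[n --> \oo] --> I].
Proof.
have bt n : (v <= n + block_threshold)%N.
  by rewrite (leq_trans le_block_threshold) // leq_addl.
(* Indices are shifted so that the dominating bound holds for every term of the sequence. *)
pose k n := (n + block_threshold)%N.
have k0 n : (0 < k n)%N by exact: leq_trans (bt n).
have ykv0 n : 0 < y (k n) ^+ v by exact/exprn_gt0/scale_gt0.
have /choice[f fP] : forall n, exists f : R -> R, [/\ measurable_fun setT f,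
    forall r, 0 <= r -> f r = prob (P (k n)) [set x | r * y (k n) ^+ v < W (k n) x] &
    ('E_(P (k n))[W (k n)] = (y (k n) ^+ v)%:E *
      \int[mu]_(r in `[0%R, +oo[) (f r)%:E)%E].
  move=> n; apply: expectation_scaled_tail => //; last exact: min_weight_lt0 (bt n).
  exact: measurable_min_weight (bt n).
have mpos : measurable pos by exact: measurable_itv.
have mF : measurable_fun pos F.
  by apply: measurable_funTS; exact: continuous_measurable_fun F_continuous.
have [C C0 hC] := tail_bound.
have posE r : pos r -> 0 <= r by rewrite /pos /= in_itv /= andbT.
have f0 n r : 0 <= r -> 0 <= f n r.
  by move=> r0; have [_ -> // _] := fP n; exact: prob_ge0.
have f_le n r : 0 <= r -> f n r <= C * (oneDsqr r)^-1.
  move=> r0; have [_ -> // _] := fP n.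
  apply: le_trans (hC _ _ (leq_addl n block_threshold) r0).
  rewrite /p -(min_weight_ge_scaled _ (bt n)); apply: le_prob.
  - exact: measurable_min_weight_gt (bt n).
  - by rewrite (min_weight_ge_scaled _ (bt n)); exact: measurable_escape.
  - by move=> x /= /ltW.
have h_int : mu.-integrable pos (fun r => ((oneDsqr r)^-1)%:E).
  apply/integrableP; split.
    apply/measurable_EFinP; apply: measurable_funTS.
    exact: continuous_measurable_fun (@continuous_oneDsqrV R).
  have abs_id r : (`|((oneDsqr r)^-1)%:E| = ((oneDsqr r)^-1)%:E :> \bar R)%E.
    by rewrite gee0_abs // lee_fin invr_ge0 (le_trans ler01) // oneDsqr_ge1.
  by under eq_integral do rewrite abs_id; rewrite integral0y_oneDsqr ltry.
have g_int : mu.-integrable pos (fun r => (C * (oneDsqr r)^-1)%:E).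
  have -> : (fun r => (C * (oneDsqr r)^-1)%:E) =
      (fun r => C%:E * ((oneDsqr r)^-1)%:E)%E by apply/funext => r.
  exact: integrableZl.
have [F_int _ cvg_int] : [/\ mu.-integrable pos (EFin \o F),
    (\int[mu]_(r in pos) `|(f n r)%:E - (F r)%:E| @[n --> \oo] --> 0)%E &
    (\int[mu]_(r in pos) (f n r)%:E @[n --> \oo] --> \int[mu]_(r in pos) (F r)%:E)%E].
  apply: (@dominated_convergence _ _ _ mu pos mpos (fun n r => (f n r)%:E)
    (fun r => (F r)%:E) (fun r => (C * (oneDsqr r)^-1)%:E)) => //.
  - by move=> n; apply/measurable_EFinP; apply: measurable_funTS; case: (fP n).
  - exact/measurable_EFinP.
  - apply: aeW => r /posE r0; apply/fine_cvgP; split; first exact: nearW.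
    have -> : fine \o (fun n => (f n r)%:E) = (fun n => prob (P (n + block_threshold)%N)
        [set x | r * y (n + block_threshold)%N ^+ v < W (n + block_threshold)%N x]).
      by apply/funext => n /=; have [_ -> // _] := fP n.
    have := cvg_prob_gt r0; rewrite -(cvg_shiftn block_threshold); exact.
  - apply: aeW => r n /posE r0; rewrite gee0_abs ?lee_fin; first exact: f_le.
    exact: f0.
have IF : (\int[mu]_(r in pos) (F r)%:E)%E \is a fin_num.
  exact: integrable_fin_num.
exists (fine (\int[mu]_(r in pos) (F r)%:E)%E); split; first by rewrite fineK.
  rewrite -lte_fin fineK //.
  (* As [F] is non-increasing on the half-line, its integral is at least [F 1]. *)
  apply: (@lt_le_trans _ _ (\int[mu]_(r in `[0%R, 1%R]) (F 1)%:E)%E).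
    rewrite integral_cst //= lebesgue_measure_itv /= lte_fin ltr01 -EFinD subr0.
    by rewrite mule1 lte_fin expR_gt0.
  apply: (@le_trans _ _ (\int[mu]_(r in `[0%R, 1%R]) (F r)%:E)%E).
    apply: ge0_le_integral => //.
    - by move=> r _; rewrite lee_fin expR_ge0.
    - apply/measurable_EFinP; apply: measurable_funTS.
      exact: continuous_measurable_fun F_continuous.
    - move=> r; rewrite /= in_itv /= => /andP[r0 r1].
      by rewrite lee_fin F_anti.
  apply: ge0_subset_integral => //.
  - exact/measurable_EFinP.
  - by move=> r _; rewrite lee_fin expR_ge0.
  - by move=> r; rewrite /pos /= !in_itv /= andbT => /andP[].
rewrite -(cvg_shiftn block_threshold).
have -> : (fun n => fine ('E_(P (n + block_threshold)%N)[W (n + block_threshold)%N]) /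
    y (n + block_threshold)%N ^+ v) = (fun n => fine (\int[mu]_(r in pos) (f n r)%:E)%E).
  apply/funext => n; have [_ _ ->] := fP n.
  by rewrite (fineZ_gt0 _ (ykv0 n)) -/(k n) mulrAC divff ?mul1r // gt_eqF.
by move: cvg_int; rewrite -(fineK IF) => /fine_cvgP[].
Qed.

Lemma min_weight_expectation :
  asymp_equiv (fun n => fine 'E_(P n)[W n])
    (fun n => n%:R `^ (- (1 / d)) *
       ((m`!%:R * a%:R) `^ (1 / m%:R) / m%:R) * Gamma (1 / m%:R)).
Proof.
have [I [IE I0 cvgI]] := expectation_min_weight.
(* The Gamma expression is the limit [I] itself, so the quotient tends to [I / I]. *)
have GE : c `^ (1 / m%:R) / m%:R * Gamma (1 / m%:R) = I.
  have := weibull_integral m0 c0; rewrite -/pos IE => /(congr1 fine) /= ->.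
  rewrite fineZ_gt0; last by rewrite divr_gt0 ?powR_gt0 // ltr0n.
  by rewrite div1r.
rewrite /asymp_equiv.
have -> : (fun n => fine 'E_(P n)[W n] / (n%:R `^ (- (1 / d)) *
       ((m`!%:R * a%:R) `^ (1 / m%:R) / m%:R) * Gamma (1 / m%:R))) =
    (fun n => (fine 'E_(P n)[W n] / y n ^+ v) * I^-1).
  apply/funext => n; rewrite -mulrA -/c GE powR_invd invfM.
  by rewrite mulrA.
have -> : (1 : R) = I * I^-1 by rewrite divff // gt_eqF.
by apply: cvgMl.
Qed.

End minimum_weight.

Theorem theorem1 (R : realType) (T : finType) (H : graph T)
    (H_balanced : strictly_balanced H) (H_edge : (0 < #|edges H|)%N)
    (disp : nat -> measure_display)
    (Omega : forall n : nat, measurableType (disp n))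
    (P : forall n : nat, probability (Omega n) R)
    (w : forall n : nat, {set 'I_n} -> {RV (P n) >-> R})
    (w_uniform : forall (n : nat) (e : {set 'I_n}),
       e \in edges (complete_graph n) -> uniform01 (w n e))
    (w_indep : forall n : nat,
       mutually_independent (edges (complete_graph n)) (w n)) :
  let m := #|edges H| in
  let a := #|automorphisms H| in
  let d : R := ratr (den H) in
  let W (n : nat) (x : Omega n) : R :=
    min_weight H (complete_graph n) (fun e => w n e x) in
  (forall z : nat -> R, (forall n, 0 <= z n) ->
     fine (P n [set x | z n / n%:R `^ (1 / d) <= W n x])
       - expR (- (z n ^+ m / (m`!%:R * a%:R))) @[n --> \oo] --> (0 : R))
  /\
  asymp_equiv (fun n => fine 'E_(P n)[W n])
    (fun n => n%:R `^ (- (1 / d)) *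
       ((m`!%:R * a%:R) `^ (1 / m%:R) / m%:R) * Gamma (1 / m%:R)).
Proof.
split; first by move=> z; exact: min_weight_distribution.
exact: min_weight_expectation.
Qed.
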